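(* Let $N$ be a $C^\infty$ manifold of dimension $1$ (without boundary), and let $\gamma: N\to \mathbb{R}^2$ be an injective $C^\infty$ immersion satisfying condition $(\ast)$: for any non-empty open set $U$ of $N$, there exists a point $q\in U$ with $\kappa(q)\neq 0$, where $\kappa$ is the curvature of $\gamma$ on a coordinate neighborhood around $q$. Then the set $$\left\{ p\in \gamma(N)\times\gamma(N) \mid D_p\circ\gamma: N\to\mathbb{R}^2 \text{ is an immersion with normal crossings}\right\}$$ is dense in $\gamma(N)\times\gamma(N)$, where $\gamma(N)\times\gamma(N)$ carries the subspace topology from $\mathbb{R}^2\times\mathbb{R}^2$.
   Context: All manifolds and mappings are of class $C^\infty$ and all manifolds are without boundary. Distance-squared mapping: for $p=(p_1,p_2)\in\mathbb{R}^2\times\mathbb{R}^2$ with $p_1=(p_{11},p_{12})$, $p_2=(p_{21},p_{22})$, the mapping $D_p:\mathbb{R}^2\to\mathbb{R}^2$ is defined by $D_p(x_1,x_2)=\left((x_1-p_{11})^2+(x_2-p_{12})^2,\ (x_1-p_{21})^2+(x_2-p_{22})^2\right)$. Normal crossings: a mapping $f:N\to\mathbb{R}^2$ from a $1$-dimensional manifold is a mapping with normal crossings if (i) for every $y\in\mathbb{R}^2$, $|f^{-1}(y)|\le 2$; and (ii) for any two different points $q_1,q_2\in N$ with $f(q_1)=f(q_2)$, $\dim\left(df_{q_1}(T_{q_1}N)+df_{q_2}(T_{q_2}N)\right)=2$. An immersion with normal crossings is an immersion that is a mapping with normal crossings. Curvature: for an immersion $\gamma=(\gamma_1,\gamma_2):N\to\mathbb{R}^2$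 and a coordinate neighborhood $(U,t)$ of $N$, the curvature $\kappa:U\to\mathbb{R}$ of $\gamma$ on $(U,t)$ is $$\kappa(t)=\frac{\det\begin{pmatrix}\frac{d\gamma_2}{dt}(t) & -\frac{d\gamma_1}{dt}(t)\\ \frac{d^2\gamma_2}{dt^2}(t) & -\frac{d^2\gamma_1}{dt^2}(t)\end{pmatrix}}{\left(\left(\frac{d\gamma_1}{dt}(t)\right)^2+\left(\frac{d\gamma_2}{dt}(t)\right)^2\right)^{3/2}}.$$ Whether $\kappa(q)=0$ at a given point $q$ does not depend on the choice of coordinate neighborhood. *)

(* Defs.v *)
From mathcomp Require Import all_boot all_order all_algebra.
From mathcomp Require Import all_classical all_reals all_analysis.

Set Implicit Arguments.
Unset Strict Implicit.
Unset Printing Implicit Defensive.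

Import Order.TTheory GRing.Theory Num.Theory.
Import numFieldNormedType.Exports.

Local Open Scope ring_scope.
Local Open Scope classical_set_scope.

(* Meant for an open set [A]: iterated derivatives at a point of [A] then only
   depend on [f] restricted to [A]. *)
Definition smooth_on (R : realType) (V : normedModType R) (A : set R)
    (f : R -> V) : Prop :=
  forall (n : nat) (t : R), A t -> derivable (derive1n n f) t 1.

(* A homeomorphism from an open subset of [N] onto an open subset of the line,
   and its inverse, both extended to total functions; their values off
   [chart_dom] and off [chart_img] are irrelevant. *)
Record chart (R : realType) (N : topologicalType) := Chart {
  chart_dom : set N;
  chart_map : N -> R;
  chart_inv : R -> N;
  open_chart_dom : open chart_dom;
  open_chart_img : open (chart_map @` chart_dom);
  chart_mapK : forall q, chart_dom q -> chart_inv (chart_map q) = q;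
  chart_map_continuous : {within chart_dom, continuous chart_map};
  chart_inv_continuous : {within chart_map @` chart_dom, continuous chart_inv} }.

Definition chart_img (R : realType) (N : topologicalType) (c : chart R N) :
  set R := chart_map c @` chart_dom c.

Definition transition_smooth (R : realType) (N : topologicalType)
    (c c' : chart R N) : Prop :=
  smooth_on (chart_map c @` (chart_dom c `&` chart_dom c')) (chart_map c' \o chart_inv c).

Definition compatible (R : realType) (N : topologicalType)
    (c c' : chart R N) : Prop :=
  transition_smooth c c' /\ transition_smooth c' c.

(* The atlas is maximal, so its elements are exactly the coordinate
   neighborhoods of the manifold. *)
Record manifold1 (R : realType) (N : topologicalType) := Manifold1 {
  atlas : set (chart R N);
  manifold_hausdorff : hausdorff_space N;
  manifold_second_countable : @second_countable N;
  atlas_cover : forall q, exists2 c, atlas c & chart_dom c q;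
  atlas_compatible : forall c c', atlas c -> atlas c' -> compatible c c';
  atlas_maximal :
    forall c, (forall c', atlas c' -> compatible c c') -> atlas c }.

Section MapsToThePlane.
Variables (R : realType) (N : topologicalType) (M : manifold1 R N).
Implicit Types (f g : N -> 'rV[R]_2) (c : chart R N) (q : N).

Definition smooth_map f : Prop :=
  forall c, atlas M c -> smooth_on (chart_img c) (f \o chart_inv c).

(* The matrix of the differential of [f] at [q] in the coordinate [c]; vectors
   are rows, so its row space is the image of the tangent line of [N] at [q]. *)
Definition differential f c q : 'rV[R]_2 := derive1 (f \o chart_inv c) (chart_map c q).

Definition immersion f : Prop :=
  smooth_map f /\
  forall c q, atlas M c -> chart_dom c q -> row_free (differential f c q).

Definition normal_crossings f : Prop :=
  (forall y : 'rV[R]_2, (f @^-1` [set y] #<= `I_2)%card) /\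
  (forall q1 q2, q1 <> q2 -> f q1 = f q2 ->
   forall c1 c2, atlas M c1 -> chart_dom c1 q1 -> atlas M c2 -> chart_dom c2 q2 ->
   \rank (differential f c1 q1 + differential f c2 q2)%MS = 2%N).

Definition immersion_with_normal_crossings f : Prop :=
  immersion f /\ normal_crossings f.

Definition curvature g c q : R :=
  let g1 t := g (chart_inv c t) 0 0 in
  let g2 t := g (chart_inv c t) 0 1 in
  let t := chart_map c q in
  \det (\matrix_(i < 2, j < 2)
          (if j == 0 then derive1n i.+1 g2 t else - derive1n i.+1 g1 t))
  / ((derive1 g1 t ^+ 2 + derive1 g2 t ^+ 2) `^ (3 / 2)).

Definition nowhere_locally_flat g : Prop :=
  forall U : set N, open U -> U !=set0 ->
  exists q c, [/\ U q, atlas M c, chart_dom c q & curvature g c q != 0].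

End MapsToThePlane.

Definition distance_squared (R : realType) (p : 'rV[R]_2 * 'rV[R]_2)
    (x : 'rV[R]_2) : 'rV[R]_2 :=
  \row_(i < 2)
    (if i == 0 then (x 0 0 - p.1 0 0) ^+ 2 + (x 0 1 - p.1 0 1) ^+ 2
     else (x 0 0 - p.2 0 0) ^+ 2 + (x 0 1 - p.2 0 1) ^+ 2).

(* Main.v *)
Require Import Defs.
From HB Require Import structures.
From mathcomp Require Import all_boot all_order all_algebra.
From mathcomp Require Import all_classical all_reals all_analysis.
From mathcomp Require Import ring lra zify.

Set Implicit Arguments.
Unset Strict Implicit.
Unset Printing Implicit Defensive.

Import Order.TTheory GRing.Theory Num.Theory.
Import numFieldNormedType.Exports.

Local Open Scope classical_set_scope.
Local Open Scope ring_scope.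

(** Let [L] be the line through two distinct centres [p.1] and [p.2]. Up to an
    affine change of coordinates in the target, the distance-squared mapping is
    the fold [(u, v) |-> (u, v ^+ 2)], where [u] runs along [L] and [v] measures
    the signed distance to [L]. Hence two points have the same image exactly when
    they are equal or mirror images in [L], and composing with the injective
    immersion [gamma] can fail to give an immersion with normal crossings in two
    ways only: [gamma] meets [L] orthogonally at some point, or two distinct
    points of the curve are mirror images in [L] with mirror-image tangent lines
    ([good_line_normal_crossings]). So it is enough to choose two centres on the
    curve such that the line joining them avoids these two families of bad lines.

    A line [y = a x + b] is the row vector [(a, b)]. Both families are meagre in
    the plane of lines. The normal lines of the curve form a one-parameter
    family. For the second family, the perpendicular bisector of
    [gamma q1, gamma q2] is a smooth function of [(q1, q2)], and a short
    computation shows that this function is critical precisely when the tangents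
    are mirror images, so the bad lines are the critical values of a map between
    surfaces and the easy case of Sard's theorem applies. That case is proved here
    by counting: a square of side [1 / n] in the parameters that contains a
    critical point is mapped into a strip of length [O(1 / n)] and width
    [O(1 / n ^+ 2)], and [O(n ^ 2)] such strips cannot be dense in an open set
    ([thin_nowhere_dense]). As the manifold is second countable, countably many
    nowhere dense sets of this kind contain all bad lines, and Baire's theorem
    gives [good_lines_dense].

    It remains to see that a good line can be found among the chords joining
    given nonempty open pieces [U1], [U2] of the curve. As the curvature does not
    vanish identically on either piece, some chord is transverse to the curve at
    both endpoints ([oblique_pair]); by the intermediate value theorem, all lines
    close to this chord still meet [U1] and [U2] ([nearby_lines_cross]). One of
    them is good, and its two intersection points are the required centres. *)

(** * Baire category and thin sets in the plane of lines *)

(** Baire's theorem is stated for normed modules that are complete; this joins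
    the norm and the completeness of row vectors. *)
HB.instance Definition _ (R : realType) :=
  Uniform_isComplete.Build 'rV[R]_2 (@cauchy_cvg ('rV[R]_2 : completeType)).

Lemma ball_rowP (R : realType) (n : nat) (u v : 'rV[R]_n.+1) (e : R) :
  0 < e -> (ball u e v <-> forall k, `|u 0 k - v 0 k| < e).
Proof.
move=> e0; split=> [[_ uv] k|uv]; first exact: uv.
by split=> // i k; rewrite [i]ord1; exact: uv.
Qed.

Lemma avoid_countably_many (R : realType) (T : countType) (S : T -> set 'rV[R]_2) :
  (forall i, dense (~` closure (S i))) ->
  forall O : set 'rV[R]_2, open O -> O !=set0 ->
  exists2 u, O u & forall i, ~ S i u.
Proof.
move=> Sd O Oo O0.
pose F n := if unpickle n is Some i then ~` closure (S i) else setT.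
have /Baire/(_ O O0 Oo)[u [Ou Fu]] : forall n, open (F n) /\ dense (F n).
  move=> n; rewrite /F; case: (unpickle n) => [i|].
    by split => //; exact/closed_openC/closed_closure.
  by split; [exact: openT | move=> P P0 _; rewrite setIT].
exists u => // i Siu; have := Fu (pickle i) I.
by rewrite /F pickleK; apply; exact: subset_closure.
Qed.

Lemma dist_natr_ge1 (R : realType) (p q : nat) : p <> q ->
  1 <= `|p%:R - q%:R : R|.
Proof.
move=> pq; wlog : p q pq / (p < q)%N => [H|lpq].
  by have [/H->//|/H|//] := ltngtP p q; [rewrite distrC; apply => /esym].
rewrite distrC ger0_norm ?subr_ge0 ?ler_nat ?(ltnW lpq)//.
by rewrite lerBrDr nat1r ler_nat.
Qed.

Lemma dist_perturb (R : realType) (x y v w : R) :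
  `|y - x| <= `|w - v| + `|x - v| + `|y - w|.
Proof.
rewrite (_ : y - x = w - v - (x - v) + (y - w)); last by ring.
by rewrite (le_trans (ler_normD _ _))// lerD2r ler_normB.
Qed.

Lemma ord2_other (i j l : 'I_2) : i != j -> l != i -> l = j.
Proof.
by case: i => -[|[|]]//= ?; case: j => -[|[|]]//= ?; case: l => -[|[|]]//= ?;
  move=> _ _; exact: val_inj.
Qed.

(** A counting form of the easy case of Sard's theorem. At scale [n] the set is
    cut into [O(n ^ 2)] cells, each lying in a strip of length [O(1 / n)] in the
    coordinate [i] and of width [O(1 / n ^+ 2)] in the coordinate [j] (the slope
    [m] of the strip varies with the cell). If the set were dense in a box, pick
    points of it close to an anisotropic grid: [k] columns, with [k] a large
    constant, spaced more than the length of a strip, and in each column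
    [O(n ^ 2)] points spaced more than the width of a strip. Different grid
    points then use different cells, and [k] can be chosen so that there are more
    grid points than cells. The parameter [z] may carry more information than the
    point [u] itself; in the applications it is a point or a pair of points of
    the curve. *)
Lemma thin_nowhere_dense (R : realType) (Z : Type)
    (P : Z -> 'rV[R]_2 -> Prop) (i j : 'I_2) (K : nat) (C : R) : i != j ->
  (forall n : nat, (0 < n)%N -> exists (T : finType) (f : Z -> T),
    (#|T| <= K * n ^ 2)%N /\
    forall z z' u v, P z u -> P z' v -> f z = f z' ->
      `|v 0 i - u 0 i| <= C / n%:R /\
      exists2 m, `|m| <= C &
        `|v 0 j - u 0 j - m * (v 0 i - u 0 i)| <= C / n%:R ^+ 2) ->
  dense (~` closure [set u | exists z, P z u]).
Proof.
move=> ij thin O [u0 Ou0] Oo; apply: contrapT => OA.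
have {}OA u : O u -> closure [set u | exists z, P z u] u.
  by move=> Ou; apply: contrapT => Au; apply: OA; exists u.
have [r /= r0 rO] : exists2 r : R, 0 < r & ball u0 r `<=` O.
  by have /nbhs_ballP[r r0 rO] := open_nbhs_nbhs (conj Oo Ou0); exists r.
have [B CB KB] : exists2 B : nat, C <= B%:R & (K < B)%N.
  exists (Num.truncn `|C| + K).+1; last by rewrite ltnS leq_addl.
  apply: le_trans (ler_norm C) _; apply/ltW/(lt_le_trans (truncnS_gt _)).
  by rewrite ler_nat -addSn leq_addr.
have B_gt0 : (0 < B)%N by exact: leq_ltn_trans KB.
(* Below, [k] is the number of columns and [J] the number of points in each
   column. Column spacing [r / k] must exceed [4 * B / n], row spacing [r / J]
   must exceed [4 * B / n ^+ 2], and the product [k * J] must exceed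
   [K * n ^ 2]; with [n = M * k] and [J = M * k ^ 2], the first two hold
   because [4 * B < r * M], the last one because [K * M < k]. *)
have [M rM] : exists M : nat, 4 * B%:R < r * M%:R.
  exists (Num.truncn (4 * B%:R / r)).+1.
  by rewrite [r * _]mulrC -ltr_pdivrMr// truncnS_gt.
have M_gt0 : (0 < M)%N.
  by case: M rM => //; rewrite mulr0 ltNge mulr_ge0.
pose k := (B * M).+1.
pose n := (M * k)%N.
pose J := (M * k ^ 2)%N.
have n0 : (0 < n)%N by rewrite muln_gt0 M_gt0.
have [T [f [Tn fP]]] := thin n n0.
pose e : R := n%:R^-1.
have e0 : 0 < e by rewrite invr_gt0 ltr0n.
have e1 : e <= 1 by rewrite invf_le1 ?ler1n ?ltr0n.
have B1 : 1 <= B%:R :> R by rewrite ler1n.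
have k0 : 0 < k%:R :> R by rewrite ltr0n.
have J0 : 0 < J%:R :> R by rewrite ltr0n muln_gt0 M_gt0.
have rk : 4 * B%:R * e < r / k%:R.
  rewrite ltr_pdivlMr// /e /n natrM invfM mulrA mulfVK ?gt_eqF//.
  by rewrite ltr_pdivrMr// ltr0n.
have rJ : 4 * B%:R * e ^+ 2 < r / J%:R.
  rewrite ltr_pdivlMr// /e /n /J !natrM.
  rewrite [X in X < _](_ : _ = 4 * B%:R / M%:R) ?ltr_pdivrMr ?ltr0n//.
  by field; rewrite !pnatr_eq0 -!lt0n /= M_gt0.
(* The points chosen near the grid move by less than [eta], which is negligible
   even against the row spacing. *)
pose eta := e ^+ 2 / 2.
have eta0 : 0 < eta by rewrite /eta; nra.
pose g (pq : 'I_k * 'I_J) : 'rV[R]_2 :=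
  \row_l (if l == i then u0 0 i + r * (pq.1%:R / k%:R)
          else u0 0 j + r * (pq.2%:R / J%:R)).
have gi pq : g pq 0 i = u0 0 i + r * (pq.1%:R / k%:R) by rewrite mxE eqxx.
have gj pq : g pq 0 j = u0 0 j + r * (pq.2%:R / J%:R).
  by rewrite mxE eq_sym (negbTE ij).
have frac (a b : nat) : (a < b)%N -> `|r * (a%:R / b%:R)| < r.
  move=> ab; rewrite ger0_norm ?mulr_ge0 ?divr_ge0 ?(ltW r0)//.
  rewrite -[ltRHS]mulr1 ltr_pM2l// ltr_pdivrMr ?mul1r ?ltr_nat// ltr0n.
  exact: leq_ltn_trans ab.
have gO pq : O (g pq).
  apply: rO; apply/ball_rowP => // l; rewrite mxE.
  case: (altP (l =P i)) => [->|li]; first by rewrite opprD addNKr normrN frac.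
  have -> : l = j by apply: ord2_other ij li.
  by rewrite opprD addNKr normrN frac.
have near_g pq : exists zv : Z * 'rV[R]_2, P zv.1 zv.2 /\ ball (g pq) eta zv.2.
  have [v [[z Pzv] gv]] := OA _ (gO pq) _ (nbhsx_ballx (g pq) eta eta0).
  by exists (z, v).
have [h hP] := choice near_g.
have inj : injective (fun pq => f (h pq).1).
  move=> [p q] [p' q'] /= fpq.
  have [Pv /(ball_rowP _ _ eta0) bv] := hP (p, q).
  have [Pv' /(ball_rowP _ _ eta0) bv'] := hP (p', q').
  have := fP _ _ _ _ Pv Pv' fpq.
  move: (bv i) (bv j) (bv' i) (bv' j); rewrite !gi !gj /=.
  set v := (h (p, q)).2; set v' := (h (p', q')).2.
  move=> vi vj v'i v'j [di [m mC dj]].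
  have ep : p = p'.
    apply: val_inj; apply: contrapT => /dist_natr_ge1 - /(_ R) pp'.
    have : r / k%:R <= `|(u0 0 i + r * (p'%:R / k%:R)) -
                         (u0 0 i + r * (p%:R / k%:R))|.
      rewrite opprD addrACA subrr add0r -mulrBr -mulrBl !normrM distrC (gtr0_norm r0).
      rewrite (gtr0_norm (_ : 0 < k%:R^-1)) ?invr_gt0// ler_pM2l//.
      by rewrite ler_peMl// invr_ge0 ltW.
    apply/negP; rewrite -ltNge; apply: le_lt_trans rk.
    apply: le_trans (dist_perturb _ _ (v 0 i) (v' 0 i)) _.
    have He : eta <= e / 2 by rewrite /eta; nra.
    have Ce : C / n%:R <= B%:R * e by rewrite ler_wpM2r // ltW.
    have Be : e <= B%:R * e by rewrite ler_peMl // ltW.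
    rewrite -mulrA; lra.
  subst p'; congr pair; apply: val_inj; apply: contrapT.
  move=> /dist_natr_ge1 - /(_ R) qq'.
  have : r / J%:R <= `|(u0 0 j + r * (q'%:R / J%:R)) -
                       (u0 0 j + r * (q%:R / J%:R))|.
    rewrite opprD addrACA subrr add0r -mulrBr -mulrBl !normrM distrC (gtr0_norm r0).
    rewrite (gtr0_norm (_ : 0 < J%:R^-1)) ?invr_gt0// ler_pM2l//.
    by rewrite ler_peMl// invr_ge0 ltW.
  apply/negP; rewrite -ltNge; apply: le_lt_trans rJ.
  apply: le_trans (dist_perturb _ _ (v 0 j) (v' 0 j)) _.
  have Ce : C / n%:R ^+ 2 <= B%:R * e ^+ 2.
    by rewrite -exprVn ler_wpM2r // exprn_ge0 // ltW.
  have Be : e ^+ 2 <= B%:R * e ^+ 2 by rewrite ler_peMl // exprn_ge0 // ltW.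
  have vij : `|m * (v' 0 i - v 0 i)| <= B%:R * e ^+ 2.
    rewrite normrM ler_pM// ?(le_trans mC)//.
    have := dist_perturb (v 0 i) (v' 0 i) (u0 0 i + r * (p%:R / k%:R))
                         (u0 0 i + r * (p%:R / k%:R)).
    rewrite subrr normr0 add0r [`|v 0 i - (_ + _)|]distrC.
    rewrite [`|v' 0 i - (_ + _)|]distrC.
    move=> /le_trans; apply; rewrite [leRHS]splitr addrC.
    by rewrite lerD // ltW.
  have vj' : `|v' 0 j - v 0 j| <= B%:R * e ^+ 2 + B%:R * e ^+ 2.
    rewrite -[X in `|X|](subrK (m * (v' 0 i - v 0 i))).
    by rewrite (le_trans (ler_normD _ _))// lerD// (le_trans dj).
  apply: le_trans (lerD (lerD vj' (ltW vj)) (ltW v'j)) _.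
  by move: Be eta0; rewrite -mulrA /eta; lra.
have := leq_trans (leq_card _ inj) Tn; rewrite card_prod !card_ord.
rewrite (_ : K * n ^ 2 = K * M * J)%N; last by rewrite /n /J expnMn; ring.
rewrite leq_pmul2r ?muln_gt0 ?M_gt0// leqNgt ltnS.
by rewrite leq_mul2r (ltnW KB) orbT.
Qed.

(** * Coordinates adapted to a line *)

Section Lines.
Variable R : realType.
Implicit Types (l x y w : 'rV[R]_2).

Definition on_line l x := x 0 1 = l 0 0 * x 0 0 + l 0 1.

(** With [across], these are coordinates along and orthogonal to the line [l],
    both multiplied by the square root of [1 + l 0 0 ^+ 2]: the scaling keeps
    them polynomial. *)
Definition along l w : R := w 0 0 + l 0 0 * w 0 1.

Definition across l w : R := w 0 1 - l 0 0 * w 0 0.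

(** Since [across l] takes the constant value [l 0 1] on the line [l], the
    second equation puts the midpoint of [x] and [y] on [l]. *)
Definition mirror l x y :=
  along l x = along l y /\ across l x + across l y = 2 * l 0 1.

(** The determinant of [w] and of the mirror image of [w'] vanishes. *)
Definition mirror_tangent l w w' :=
  along l w * across l w' + across l w * along l w' = 0.

Lemma alongD l x w c : along l (x + c *: w) = along l x + c * along l w.
Proof. by rewrite /along !mxE; ring. Qed.

Lemma acrossD l x w c : across l (x + c *: w) = across l x + c * across l w.
Proof. by rewrite /across !mxE; ring. Qed.

Lemma alongZ l w c : along l (c *: w) = c * along l w.
Proof. by rewrite /along !mxE; ring. Qed.

Lemma acrossZ l w c : across l (c *: w) = c * across l w.
Proof. by rewrite /across !mxE; ring. Qed.

Lemma mirror_tangentZ l w w' c d :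
  mirror_tangent l w w' -> mirror_tangent l (c *: w) (d *: w').
Proof.
rewrite /mirror_tangent !alongZ !acrossZ => tan.
by rewrite mulrACA [X in _ + X]mulrACA -mulrDr tan mulr0.
Qed.

Lemma row2P x y : x 0 0 = y 0 0 -> x 0 1 = y 0 1 -> x = y.
Proof.
move=> xy0 xy1; apply/rowP => i; case: (altP (i =P 0)) => [->//|i0].
by rewrite (@ord2_other 0 1 i).
Qed.

Lemma along_across_inj l x y :
  along l x = along l y -> across l x = across l y -> x = y.
Proof.
rewrite /along /across => al ac.
have x0 : (x 0 0 - y 0 0) * (1 + l 0 0 ^+ 2) = 0.
  have E : x 0 1 = y 0 1 + l 0 0 * (x 0 0 - y 0 0) by lra.
  by move: al; rewrite E; lra.
have {}x0 : x 0 0 = y 0 0.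
  apply/eqP; rewrite -subr_eq0; move/eqP: x0; rewrite mulf_eq0 => /orP[//|].
  by rewrite gt_eqF// ltr_wpDr// sqr_ge0.
by apply: row2P => //; move: ac; rewrite x0 => /addIr.
Qed.

End Lines.

Section NormBounds.
Variable R : realType.
Implicit Types (a b c d : R).

Lemma normD_le a b c d : `|a| <= c -> `|b| <= d -> `|a + b| <= c + d.
Proof. by move=> ac bd; rewrite (le_trans (ler_normD _ _))// lerD. Qed.

Lemma normB_le a b c d : `|a| <= c -> `|b| <= d -> `|a - b| <= c + d.
Proof. by move=> ac bd; apply: normD_le; rewrite ?normrN. Qed.

Lemma normM_le a b c d : `|a| <= c -> `|b| <= d -> `|a * b| <= c * d.
Proof. by move=> ac bd; rewrite normrM ler_pM. Qed.

(** Lower bounds are written [1 <= d * `|b|], with [d] a natural number in the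
    applications, so that every nonzero [b] satisfies one of countably many
    such bounds. *)
Lemma norm_le_of_mul a b c d : 1 <= d * `|b| -> `|a * b| <= c -> `|a| <= d * c.
Proof.
move=> db abc; have d0 : 0 <= d.
  rewrite leNgt; apply/negP => d0; move: db; rewrite leNgt.
  by rewrite (le_lt_trans _ ltr01)// mulr_le0_ge0// ltW.
apply: le_trans (ler_wpM2l d0 abc); rewrite normrM mulrCA.
by rewrite ler_peMr.
Qed.

End NormBounds.

(** * Arcs with uniform second-order estimates *)

Section Tame.
Variables (R : realType) (N : Type) (g : N -> 'rV[R]_2).

(** The estimates that the counting arguments need on a piece [U] of the curve
    [g], with coordinate [t] and velocity [v]. They hold near every point
    ([local_tame]) and pass to subsets, so that they can be imposed on the
    members of a countable basis. *)
Record tame (t : N -> R) (v : N -> 'rV[R]_2) (U : set N) (k : nat) : Prop := {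
  tame_coord : forall q, U q -> `|t q| <= k%:R;
  tame_pos : forall q i, U q -> `|g q 0 i| <= k%:R;
  tame_vel : forall q i, U q -> `|v q 0 i| <= k%:R;
  tame_vel_lip : forall q q' i, U q -> U q' ->
    `|v q' 0 i - v q 0 i| <= k%:R * `|t q' - t q|;
  tame_taylor : forall q q' i, U q -> U q' ->
    `|g q' 0 i - g q 0 i - v q 0 i * (t q' - t q)| <= k%:R * `|t q' - t q| ^+ 2 }.

Lemma tame_lip t v U k : tame t v U k -> forall q q' i (h : R), U q -> U q' ->
  `|t q' - t q| <= h -> h <= 1 -> `|g q' 0 i - g q 0 i| <= 2 * k%:R * h.
Proof.
move=> T q q' i h Uq Uq' th h1.
rewrite -(subrK (v q 0 i * (t q' - t q)) (g q' 0 i - g q 0 i)).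
have h0 : 0 <= h := le_trans (normr_ge0 _) th.
have H1 : `|t q' - t q| ^+ 2 <= h by have := normr_ge0 (t q' - t q); nra.
apply: le_trans (normD_le (tame_taylor T i Uq Uq')
                          (normM_le (tame_vel T i Uq) th)) _.
have k0 : 0 <= k%:R :> R by [].
nra.
Qed.

Lemma grid_cells (k n : nat) : (0 < n)%N ->
  exists f : R -> 'I_((2 * k * n).+1), forall s t,
  `|s| <= k%:R -> `|t| <= k%:R -> f s = f t -> `|t - s| <= n%:R^-1.
Proof.
move=> n0; exists (fun s => inord (Num.truncn (n%:R * (s + k%:R)))) => s t.
rewrite !ler_norml => /andP[s1 s2] /andP[t1 t2].
have n0' : 0 < n%:R :> R by rewrite ltr0n.
have bd (u : R) : - k%:R <= u -> u <= k%:R ->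
    0 <= n%:R * (u + k%:R) /\
    (Num.truncn (n%:R * (u + k%:R)) < (2 * k * n).+1)%N.
  move=> u1 u2; have H : 0 <= n%:R * (u + k%:R) by rewrite mulr_ge0// ; lra.
  split => //; rewrite truncn_lt_nat// -natr1 !natrM; nra.
have [s3 s4] := bd _ s1 s2; have [t3 t4] := bd _ t1 t2.
move=> /(congr1 val); rewrite /= !inordK// => st.
have /andP[] := truncn_itv s3; have /andP[] := truncn_itv t3; rewrite -st -natr1.
move: (_%:R) => w *.
rewrite -ler_norml -(ler_pM2l n0') mulfV ?gt_eqF//.
rewrite -[X in X * _]gtr0_norm// -normrM ler_norml.
by apply/andP; split; lra.
Qed.

End Tame.

(** * The bad lines of tame arcs form nowhere dense sets *)

Section NormalLines.
Variables (R : realType) (N : Type) (g : N -> 'rV[R]_2).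
Implicit Types (l w : 'rV[R]_2).

Lemma along_le l w (c m : R) : `|l 0 0| <= m -> (forall i, `|w 0 i| <= c) ->
  `|along l w| <= (1 + m) * c.
Proof.
by move=> lm wc; rewrite mulrDl mul1r; apply: normD_le => //; exact: normM_le.
Qed.

Lemma across_le l w (c m : R) : `|l 0 0| <= m -> (forall i, `|w 0 i| <= c) ->
  `|across l w| <= (1 + m) * c.
Proof.
by move=> lm wc; rewrite mulrDl mul1r; apply: normB_le => //; exact: normM_le.
Qed.

(** A normal line is a Lipschitz function of its foot point, so [O(n ^ 2)] arcs
    of length [1 / n ^+ 2] give normal lines that are [O(1 / n ^+ 2)] apart in
    both coordinates: much less than [thin_nowhere_dense] asks for. *)
Lemma normal_lines_nowhere_dense t v U k (m : nat) : tame g t v U k ->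
  dense (~` closure [set l | exists q, [/\ U q, on_line l (g q),
    along l (v q) = 0, `|l 0 0| <= m%:R & 1 <= m%:R * `|v q 0 1|]]).
Proof.
move=> T.
pose C : R := m%:R * ((1 + m%:R) * k%:R) +
  ((1 + m%:R) * (2 * k%:R) + m%:R * ((1 + m%:R) * k%:R) * k%:R).
have [m0 k0] : 0 <= m%:R :> R /\ 0 <= k%:R :> R by [].
apply: (@thin_nowhere_dense R N _ 0 1 (2 * k).+1 C) => // n n0.
have n20 : (0 < n ^ 2)%N by rewrite expn_gt0 n0.
have [f fP] := grid_cells R k n20.
exists 'I_(2 * k * n ^ 2).+1, (f \o t); split.
  by rewrite card_ord; nia.
move=> q q' l l' [Uq lq aq lm _] [Uq' lq' aq' lm' vm'] /= fq.
set h : R := (n ^ 2)%:R^-1.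
have th : `|t q' - t q| <= h by apply: fP => //; exact: tame_coord T _ _.
have h0 : 0 <= h by rewrite invr_ge0.
have h1 : h <= 1 by rewrite invf_le1 ?ler1n ?ltr0n.
have da : `|l' 0 0 - l 0 0| <= m%:R * ((1 + m%:R) * (k%:R * h)).
  apply: norm_le_of_mul vm' _.
  rewrite (_ : _ * _ = - along l (v q' - v q)); last first.
    by move: aq aq'; rewrite /along !mxE; lra.
  rewrite normrN; apply: along_le => // i; rewrite !mxE.
  by apply: le_trans (tame_vel_lip T i Uq Uq') _; rewrite ler_wpM2l.
have db : `|l' 0 1 - l 0 1| <= (1 + m%:R) * (2 * k%:R * h) +
   m%:R * ((1 + m%:R) * (k%:R * h)) * k%:R.
  rewrite (_ : _ - _ = across l (g q' - g q) -
                       (l' 0 0 - l 0 0) * g q' 0 0); last first.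
    by move: lq lq'; rewrite /across !mxE /on_line => -> ->; ring.
  apply: normB_le; last by apply: normM_le => //; exact: tame_pos T _ _ _.
  apply: across_le => // i; rewrite !mxE.
  exact: tame_lip T _ _ _ _ _ _ th h1.
have A0 : 0 <= m%:R * ((1 + m%:R) * k%:R) :> R.
  by rewrite mulr_ge0// mulr_ge0// addr_ge0.
have B0 : 0 <= (1 + m%:R) * (2 * k%:R) +
    m%:R * ((1 + m%:R) * k%:R) * k%:R :> R.
  by rewrite addr_ge0// mulr_ge0// ?mulr_ge0// addr_ge0.
have C0 : 0 <= C by rewrite addr_ge0.
split.
  apply: le_trans da _; apply: (@le_trans _ _ (C * h)).
    by rewrite mulrA mulrA -[m%:R * _ * _]mulrA ler_wpM2r// /C; lra.
  by rewrite ler_wpM2l// lef_pV2 ?posrE ?ltr0n// ler_nat; exact: (@leq_pexp2l n 1 2).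
exists 0; first by rewrite normr0.
rewrite mul0r subr0 -natrX; apply: le_trans db _.
rewrite -/h /C [leRHS]mulrDl.
rewrite [X in _ <= _ + X](_ : _ = (1 + m%:R) * (2 * k%:R * h) +
   m%:R * ((1 + m%:R) * (k%:R * h)) * k%:R); last by ring.
by rewrite lerDr mulr_ge0.
Qed.

End NormalLines.

Section Mirrors.
Variables (R : realType) (N : Type) (g : N -> 'rV[R]_2).
Variables (t1 : N -> R) (v1 : N -> 'rV[R]_2) (U1 : set N) (k1 : nat).
Variables (t2 : N -> R) (v2 : N -> 'rV[R]_2) (U2 : set N) (k2 : nat).
Hypotheses (T1 : tame g t1 v1 U1 k1) (T2 : tame g t2 v2 U2 k2).
Variable m : nat.
Implicit Types (l : 'rV[R]_2) (z : N * N).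

(** A bad pair [z] for the line [l]. The last two bounds make the constants
    uniform: every bad pair satisfies them for some [m], because mirror images
    in [l] with equal ordinates coincide. *)
Definition mirror_pair z l := [/\ U1 z.1 /\ U2 z.2, mirror l (g z.1) (g z.2),
  mirror_tangent l (v1 z.1) (v2 z.2), `|l 0 0| <= m%:R &
  1 <= m%:R * `|g z.2 0 1 - g z.1 0 1|].

Definition close_pairs z z' (h : R) :=
  [/\ `|t1 z'.1 - t1 z.1| <= h, `|t2 z'.2 - t2 z.2| <= h, 0 <= h & h <= 1].

Lemma mirror_pairs_nowhere_dense (P : N * N -> 'rV[R]_2 -> Prop)
    (i j : 'I_2) (C : R) : i != j ->
  (forall z z' l l' h, mirror_pair z l -> mirror_pair z' l' -> P z l -> P z' l' ->
     close_pairs z z' h -> `|l' 0 i - l 0 i| <= C * h /\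
     exists2 M, `|M| <= C &
       `|l' 0 j - l 0 j - M * (l' 0 i - l 0 i)| <= C * h ^+ 2) ->
  dense (~` closure [set l | exists z, mirror_pair z l /\ P z l]).
Proof.
move=> ij Pest.
apply: (@thin_nowhere_dense R (N * N) _ i j ((2 * k1).+1 * (2 * k2).+1) C) => //.
move=> n n0; have [f1 f1P] := grid_cells R k1 n0.
have [f2 f2P] := grid_cells R k2 n0.
exists ('I_(2 * k1 * n).+1 * 'I_(2 * k2 * n).+1)%type.
exists (fun z => (f1 (t1 z.1), f2 (t2 z.2))); split.
  rewrite card_prod !card_ord -mulnn mulnACA leq_mul//;
  by rewrite [leqRHS]mulSn -[leqLHS]add1n leq_add.
move=> z z' l l' [Pz PPz] [Pz' PPz'] [fz1 fz2].
rewrite -exprVn; apply: (Pest z z') => //.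
have [[Uz1 Uz2] _ _ _ _] := Pz; have [[Uz1' Uz2'] _ _ _ _] := Pz'.
split.
- exact: f1P (tame_coord T1 Uz1) (tame_coord T1 Uz1') fz1.
- exact: f2P (tame_coord T2 Uz2) (tame_coord T2 Uz2') fz2.
- by rewrite invr_ge0.
- by rewrite invf_le1 ?ler1n ?ltr0n.
Qed.

(** A bad pair is a critical point of the perpendicular bisector. Subtracting
    the equations of [mirror] for two bad pairs expresses the change of slope and
    of height through the displacements of the two points ([slope_eq] and
    [height_eq] below). Weighted by [along l w] and [across l w], where [w] is
    the velocity at the first point, the first-order terms cancel: those of the
    first point identically, those of the second one by [mirror_tangent]. The
    remaining linear form in the change of the line is thus of second order. *)
Lemma mirror_pair_estimates : exists2 C : R, 0 <= C &
  forall z z' l l' h,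
  mirror_pair z l -> mirror_pair z' l' -> close_pairs z z' h ->
  [/\ `|l' 0 0 - l 0 0| <= C * h, `|l' 0 1 - l 0 1| <= C * h &
    `|along l (v1 z.1) * (2 * (l' 0 1 - l 0 1) +
         (l' 0 0 - l 0 0) * (g z'.1 0 0 + g z'.2 0 0)) -
      across l (v1 z.1) * ((l' 0 0 - l 0 0) * (g z'.2 0 1 - g z'.1 0 1))|
    <= C * h ^+ 2].
Proof.
pose k : R := k1%:R + k2%:R; pose s : R := 1 + m%:R.
have k10 : 0 <= k1%:R :> R by [].
have k20 : 0 <= k2%:R :> R by [].
have m0 : 0 <= m%:R :> R by [].
have k0 : 0 <= k by rewrite addr_ge0.
have s0 : 0 <= s by rewrite addr_ge0.
have k1k : k1%:R <= k by rewrite lerDl.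
have k2k : k2%:R <= k by rewrite lerDr.
pose A : R := m%:R * (s * (2 * k) + s * (2 * k)).
pose B : R := s * (2 * k) + s * (2 * k) + A * (k + k).
pose Q : R := (s * k) * (s * k + s * k) + (s * k) * (s * k + s * k).
have A0 : 0 <= A.
  by do ![assumption|apply: addr_ge0|apply: mulr_ge0|exact: ler0n].
have B0 : 0 <= B.
  by do ![assumption|apply: addr_ge0|apply: mulr_ge0|exact: ler0n].
have Q0 : 0 <= Q.
  by do ![assumption|apply: addr_ge0|apply: mulr_ge0|exact: ler0n].
exists (A + B + Q); first by rewrite (addr_ge0 (addr_ge0 A0 B0) Q0).
move=> z z' l l' h [[Uz1 Uz2] [mir1 mir2] tan lm ym].
move=> [[Uz1' Uz2'] [mir1' mir2'] tan' lm' ym'] [th1 th2 h0 h1].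
have hh : 0 <= h ^+ 2 by rewrite exprn_ge0.
have G1 i : `|(g z'.1 - g z.1) 0 i| <= 2 * k * h.
  rewrite !mxE; apply: le_trans (tame_lip T1 i Uz1 Uz1' th1 h1) _.
  by rewrite ler_wpM2r// ler_wpM2l.
have G2 i : `|(g z'.2 - g z.2) 0 i| <= 2 * k * h.
  rewrite !mxE; apply: le_trans (tame_lip T2 i Uz2 Uz2' th2 h1) _.
  by rewrite ler_wpM2r// ler_wpM2l.
have slope_eq : (l' 0 0 - l 0 0) * (g z'.2 0 1 - g z'.1 0 1) =
    along l (g z'.1 - g z.1) - along l (g z'.2 - g z.2).
  by move: mir1 mir1'; rewrite /along !mxE; lra.
have height_eq : 2 * (l' 0 1 - l 0 1) +
      (l' 0 0 - l 0 0) * (g z'.1 0 0 + g z'.2 0 0) =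
    across l (g z'.1 - g z.1) + across l (g z'.2 - g z.2).
  by move: mir2 mir2'; rewrite /across !mxE; lra.
have da : `|l' 0 0 - l 0 0| <= A * h.
  rewrite /A -mulrA; apply: norm_le_of_mul ym' _; rewrite [leRHS]mulrDl -!(mulrA s).
  by rewrite slope_eq; apply: normB_le; exact: along_le.
have db : `|l' 0 1 - l 0 1| <= B * h.
  have : `|2 * (l' 0 1 - l 0 1)| <= B * h.
    rewrite -[X in `|X|](addrK ((l' 0 0 - l 0 0) * (g z'.1 0 0 + g z'.2 0 0))).
    rewrite height_eq.
    rewrite [leRHS](_ : _ = s * (2 * k * h) + s * (2 * k * h) +
                            A * h * (k + k)).
      apply: normB_le; first by apply: normD_le; exact: across_le.
      apply: normM_le => //; apply: normD_le.
        exact: le_trans (tame_pos T1 _ Uz1') k1k.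
      exact: le_trans (tame_pos T2 _ Uz2') k2k.
    by rewrite /B; ring.
  rewrite normrM ger0_norm//; apply: le_trans.
  by rewrite mulr_natl mulr2n lerDl.
have bd1 : A * h <= (A + B + Q) * h by rewrite ler_wpM2r//; lra.
have bd2 : B * h <= (A + B + Q) * h by rewrite ler_wpM2r//; lra.
have bd3 : Q * h ^+ 2 <= (A + B + Q) * h ^+ 2 by rewrite ler_wpM2r//; lra.
split; [exact: le_trans da bd1 | exact: le_trans db bd2 |].
apply: le_trans bd3.
(* Second-order remainders of the displacements. *)
pose e1 := g z'.1 - g z.1 - (t1 z'.1 - t1 z.1) *: v1 z.1.
pose e2 := g z'.2 - g z.2 - (t2 z'.2 - t2 z.2) *: v2 z.2.
have E1 i : `|e1 0 i| <= k * h ^+ 2.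
  rewrite !mxE mulrC; apply: le_trans (tame_taylor T1 i Uz1 Uz1') _.
  by rewrite ler_pM// ?exprn_ge0// lerXn2r ?nnegrE.
have E2 i : `|e2 0 i| <= k * h ^+ 2.
  rewrite !mxE mulrC; apply: le_trans (tame_taylor T2 i Uz2 Uz2') _.
  by rewrite ler_pM// ?exprn_ge0// lerXn2r ?nnegrE.
have V1 i : `|v1 z.1 0 i| <= k by apply: le_trans (tame_vel T1 _ Uz1) k1k.
rewrite [X in `|X|](_ : _ = along l (v1 z.1) * (across l e1 + across l e2) -
   across l (v1 z.1) * (along l e1 - along l e2)); last first.
  rewrite height_eq slope_eq.
  rewrite -(subrK ((t1 z'.1 - t1 z.1) *: v1 z.1) (g z'.1 - g z.1)) -/e1.
  rewrite -(subrK ((t2 z'.2 - t2 z.2) *: v2 z.2) (g z'.2 - g z.2)) -/e2.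
  rewrite !alongD !acrossD; move/eqP: tan.
  rewrite /mirror_tangent addrC addr_eq0.
  by move/eqP => tan; ring: tan.
rewrite [leRHS](_ : _ = (s * k) * (s * (k * h ^+ 2) + s * (k * h ^+ 2)) +
   (s * k) * (s * (k * h ^+ 2) + s * (k * h ^+ 2))); last by rewrite /Q; ring.
apply: normB_le; apply: normM_le; do ?exact: along_le; do ?exact: across_le.
  by apply: normD_le; exact: across_le.
by apply: normB_le; exact: along_le.
Qed.

(** If the tangent at the first point is not orthogonal to the line, the linear
    form of [mirror_pair_estimates] can be solved for the height: the bad lines
    lie in strips that are graphs over the slope. *)
Lemma oblique_mirrors_nowhere_dense :
  dense (~` closure [set l | exists z, mirror_pair z l /\
    1 <= m%:R * `|along l (v1 z.1)|]).
Proof.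
have [C C0 est] := mirror_pair_estimates.
pose D : R := (1 + m%:R) * k1%:R * (k2%:R + k1%:R) +
  (1 + m%:R) * k1%:R * (k1%:R + k2%:R).
have [m0 [k10 k20]] : 0 <= m%:R :> R /\ 0 <= k1%:R :> R /\ 0 <= k2%:R :> R by [].
have D0 : 0 <= D by rewrite addr_ge0// !mulr_ge0// addr_ge0.
have mC0 : 0 <= m%:R * C by exact: mulr_ge0.
have mD0 : 0 <= m%:R * D by exact: mulr_ge0.
apply: (@mirror_pairs_nowhere_dense _ 0 1 (C + m%:R * C + m%:R * D)) => //.
move=> z z' l l' h Pz Pz' vz vz' cl; have [da db lin] := est _ _ _ _ _ Pz Pz' cl.
have [_ _ h0 h1] := cl.
have [[Uz1 Uz2] _ _ lm _] := Pz; have [[Uz1' Uz2'] _ _ _ _] := Pz'.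
have hh : 0 <= h ^+ 2 by rewrite exprn_ge0.
split; first by apply: le_trans da _; rewrite ler_wpM2r//; lra.
have v0 : along l (v1 z.1) != 0.
  by apply/eqP => v0; move: vz; rewrite v0 normr0 mulr0 ler10.
pose M := (across l (v1 z.1) * (g z'.2 0 1 - g z'.1 0 1) -
           along l (v1 z.1) * (g z'.1 0 0 + g z'.2 0 0)) /
          (2 * along l (v1 z.1)).
have half (x : R) c : `|x| <= c -> `|x / 2| <= c.
  move=> xc; rewrite normrM [`|2^-1|]ger0_norm// (le_trans _ xc)//.
  by rewrite ler_piMr//; lra.
exists M.
  apply: (@le_trans _ _ (m%:R * D)); last by lra.
  apply: norm_le_of_mul vz _.
  rewrite (_ : M * _ = (across l (v1 z.1) * (g z'.2 0 1 - g z'.1 0 1) -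
           along l (v1 z.1) * (g z'.1 0 0 + g z'.2 0 0)) / 2); last first.
    by rewrite /M; field.
  apply: half; apply: normB_le; apply: normM_le.
  - by apply: across_le => // i; exact: tame_vel T1 _ _ _.
  - by apply: normB_le; [exact: tame_pos T2 _ _ _|exact: tame_pos T1 _ _ _].
  - by apply: along_le => // i; exact: tame_vel T1 _ _ _.
  - by apply: normD_le; [exact: tame_pos T1 _ _ _|exact: tame_pos T2 _ _ _].
apply: (@le_trans _ _ (m%:R * (C * h ^+ 2))).
  apply: norm_le_of_mul vz _.
  rewrite [X in `|X|](_ : _ =
    (along l (v1 z.1) * (2 * (l' 0 1 - l 0 1) +
         (l' 0 0 - l 0 0) * (g z'.1 0 0 + g z'.2 0 0)) -
      across l (v1 z.1) * ((l' 0 0 - l 0 0) * (g z'.2 0 1 - g z'.1 0 1))) / 2).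
    exact: half.
  by rewrite /M; field.
by rewrite mulrA ler_wpM2r//; lra.
Qed.

(** If the tangent is orthogonal to the line, the linear form of
    [mirror_pair_estimates] involves the slope alone, and the strips are
    vertical in the plane of lines. *)
Lemma perpendicular_mirrors_nowhere_dense :
  dense (~` closure [set l | exists z, mirror_pair z l /\
    (along l (v1 z.1) = 0 /\ 1 <= m%:R * `|across l (v1 z.1)|)]).
Proof.
have [C C0 est] := mirror_pair_estimates.
have m0 : 0 <= m%:R :> R by [].
have mC0 : 0 <= m%:R * (m%:R * C) by rewrite !mulr_ge0.
apply: (@mirror_pairs_nowhere_dense _ 1 0 (C + m%:R * (m%:R * C))) => //.
move=> z z' l l' h Pz Pz' [vz wz] [vz' wz'] cl.
have [da db] := est _ _ _ _ _ Pz Pz' cl; rewrite vz mul0r sub0r normrN => lin.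
have [_ _ h0 h1] := cl; have [_ _ _ _ yz'] := Pz'.
have hh : 0 <= h ^+ 2 by rewrite exprn_ge0.
split; first by apply: le_trans db _; rewrite ler_wpM2r//; lra.
exists 0; first by rewrite normr0 addr_ge0.
rewrite mul0r subr0; apply: (@le_trans _ _ (m%:R * (m%:R * (C * h ^+ 2)))).
  by apply: norm_le_of_mul yz' _; apply: norm_le_of_mul wz _; rewrite mulrC.
rewrite [leLHS](_ : _ = m%:R * (m%:R * C) * h ^+ 2); last by ring.
by rewrite ler_wpM2r//; lra.
Qed.

End Mirrors.

(** * Smoothness of products and of row-valued maps *)

Section Smooth.
Variables (R : realType) (A : set R).
Hypothesis Ao : open A.

Lemma near_open (t : R) : A t -> \forall s \near t, A s.
Proof. by move=> At; exact: open_nbhs_nbhs. Qed.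

Lemma derive1_eq_on (V : normedModType R) (f g : R -> V) :
  {in A, f =1 g} -> {in A, derive1 f =1 derive1 g}.
Proof.
move=> fg t /set_mem At; rewrite !derive1E; apply: near_eq_derive.
by apply: filterS (near_open At) => s As; apply/fg/mem_set.
Qed.

Lemma derivable_eq_on (V : normedModType R) (f g : R -> V) t :
  {in A, f =1 g} -> A t -> derivable f t 1 -> derivable g t 1.
Proof.
move=> fg At; apply: near_eq_derivable.
by apply: filterS (near_open At) => s As; apply/fg/mem_set.
Qed.

Lemma derive1n_eq_on (V : normedModType R) n (f g : R -> V) :
  {in A, f =1 g} -> {in A, derive1n n f =1 derive1n n g}.
Proof.
by elim: n => // n IHn fg; rewrite !derive1nS; apply/derive1_eq_on/IHn.
Qed.

(** Smoothness of a product is proved by induction on the order, and the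
    derivative of [f * g] involves [f] and [g] themselves next to their
    derivatives; this bounded version of [smooth_on] makes the induction go
    through. *)
Definition diff_upto (V : normedModType R) n (f : R -> V) :=
  forall k t, (k <= n)%N -> A t -> derivable (derive1n k f) t 1.

Lemma smooth_onP (V : normedModType R) (f : R -> V) :
  smooth_on A f <-> forall n, diff_upto n f.
Proof.
by split=> [fs n k t _|fs n t]; [exact: fs|exact: (fs n n)].
Qed.

Lemma diff_uptoS (V : normedModType R) n (f : R -> V) :
  diff_upto n.+1 f <->
  (forall t, A t -> derivable f t 1) /\ diff_upto n (derive1 f).
Proof.
split=> [fs|[f0 fs] [|k] t kn At]; last 2 first.
- exact: f0.
- by rewrite derive1Sn; exact: fs.
by split=> [t At|k t kn At]; [exact: (fs 0%N)|rewrite -derive1Sn; exact: fs].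
Qed.

Lemma diff_upto_eq (V : normedModType R) n (f g : R -> V) :
  {in A, f =1 g} -> diff_upto n f -> diff_upto n g.
Proof.
move=> fg fs k t kn At; apply: derivable_eq_on (fs k t kn At) => //.
exact: derive1n_eq_on.
Qed.

Lemma diff_uptoW (V : normedModType R) n (f : R -> V) :
  diff_upto n.+1 f -> diff_upto n f.
Proof. by move=> fs k t kn; apply: fs; rewrite (leq_trans kn). Qed.

Lemma diff_uptoD n (f g : R -> R) :
  diff_upto n f -> diff_upto n g -> diff_upto n (f + g).
Proof.
elim: n f g => [|n IHn] f g.
  move=> fs gs [|//] t _ At.
  by apply: derivableD; [exact: (fs 0%N)|exact: (gs 0%N)].
move=> /diff_uptoS[f0 fs] /diff_uptoS[g0 gs]; apply/diff_uptoS; split.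
  by move=> t At; apply: derivableD; [exact: f0|exact: g0].
apply: diff_upto_eq (IHn _ _ fs gs) => t /set_mem At.
by rewrite derive1E deriveD ?fctE ?derive1E//; [exact: f0|exact: g0].
Qed.

Lemma diff_uptoM n (f g : R -> R) :
  diff_upto n f -> diff_upto n g -> diff_upto n (f * g).
Proof.
elim: n f g => [|n IHn] f g.
  move=> fs gs [|//] t _ At.
  by apply: derivableM; [exact: (fs 0%N)|exact: (gs 0%N)].
move=> fs' gs'; have /diff_uptoS[f0 fs] := fs'; have /diff_uptoS[g0 gs] := gs'.
apply/diff_uptoS; split.
  by move=> t At; apply: derivableM; [exact: f0|exact: g0].
apply: diff_upto_eq (diff_uptoD (IHn _ _ fs (diff_uptoW gs'))
                                (IHn _ _ (diff_uptoW fs') gs)).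
move=> t /set_mem At; rewrite derive1E deriveM; [|exact: f0|exact: g0].
by rewrite !fctE !derive1E addrC; congr (_ + _); rewrite mulrC.
Qed.

Lemma diff_upto_cst n (c : R) : diff_upto n (cst c).
Proof.
elim: n c => [|n IHn] c; first by case=> // t _ _; exact: derivable_cst.
apply/diff_uptoS; split; first by move=> *; exact: derivable_cst.
by apply: diff_upto_eq (IHn 0) => t _; rewrite derive1_cst.
Qed.

Lemma coord_derive1n_smooth (f : R -> 'rV[R]_2) i : smooth_on A f ->
  forall n, {in A, derive1n n (fun t => f t 0 i) =1
                   (fun t => derive1n n f t 0 i)}.
Proof.
move=> fs; elim=> // n IHn t tA; have /set_mem At := tA.
rewrite !derive1nS (derive1_eq_on IHn)// !derive1E derive_mx ?mxE//.
exact: fs.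
Qed.

Lemma smooth_on_coord (f : R -> 'rV[R]_2) i : smooth_on A f ->
  smooth_on A (fun t => f t 0 i).
Proof.
move=> fs n t At; apply: (@derivable_eq_on _ (fun t => derive1n n f t 0 i)) => //.
  by move=> s sA; rewrite (coord_derive1n_smooth i fs).
by have /derivable_mxP := fs n t At; apply.
Qed.

Lemma smooth_on_row (f : R -> 'rV[R]_2) :
  (forall i, smooth_on A (fun t => f t 0 i)) -> smooth_on A f.
Proof.
move=> fs.
suff H n : (forall i, {in A, derive1n n (fun t => f t 0 i) =1
                             (fun t => derive1n n f t 0 i)}).
  move=> n t At; apply/derivable_mxP => k i; rewrite [k]ord1.
  by apply: derivable_eq_on (fs i n t At) => //; exact: H.
elim: n => // n IHn i t tA; have /set_mem At := tA.
rewrite !derive1nS (derive1_eq_on (IHn i))// !derive1E derive_mx ?mxE//.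
apply/derivable_mxP => k j; rewrite [k]ord1.
by apply: derivable_eq_on (fs j n t At) => //; exact: IHn.
Qed.

End Smooth.

(** * The curve in charts *)

Section LocalBounds.
Variable R : realType.
Implicit Types f : R -> R.

Lemma derivable_continuous_at f t : derivable f t 1 -> f x @[x --> t] --> f t.
Proof. by move=> /derivable1_diffP /differentiable_continuous. Qed.

Lemma near_bounded f t : f x @[x --> t] --> f t ->
  exists k : nat, \forall s \near t, `|f s| <= k%:R.
Proof.
move=> /cvgr_dist_lt /(_ 1 ltr01) ft.
exists (Num.truncn (`|f t| + 1)).+1; apply: filterS ft => s fs.
apply/ltW; apply: lt_trans (truncnS_gt _).
rewrite -ltrBlDl (le_lt_trans _ fs)// (le_trans (lerB_dist _ _))//.
by rewrite distrC.
Qed.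

Lemma near_bounded2 (f : 'I_2 -> R -> R) t :
  (forall i, f i x @[x --> t] --> f i t) ->
  exists k : nat, \forall s \near t, forall i, `|f i s| <= k%:R.
Proof.
move=> ft; have [k0 fk0] := near_bounded (ft 0); have [k1 fk1] := near_bounded (ft 1).
exists (k0 + k1)%N; apply: filterS2 fk0 fk1 => s fk0 fk1 i.
rewrite natrD; case: (altP (i =P 0)) => [->|i0]; first by rewrite ler_wpDr.
by rewrite (@ord2_other 0 1 i)// ler_wpDl.
Qed.

Lemma mean_value f (t e s s' : R) :
  (forall x, ball t e x -> derivable f x 1) -> ball t e s -> ball t e s' ->
  exists x, [/\ ball t e x, `|x - s| <= `|s' - s|, `|x - s'| <= `|s' - s| &
    f s' - f s = derive1 f x * (s' - s)].
Proof.
move=> fd; wlog ss' : s s' / s <= s' => [H|bs bs'].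
  case: (leP s s') => [|/ltW s's] bs bs'; first by move=> ss'; exact: H.
  have [x [bx xs' xs E]] := H s' s s's bs' bs; exists x; split => //.
  - by rewrite [leRHS]distrC.
  - by rewrite [leRHS]distrC.
  - by rewrite -opprB E -mulrN opprB.
have sub x : s <= x <= s' -> ball t e x.
  move: bs bs'; rewrite /ball /= !ltr_norml => /andP[? ?] /andP[? ?] /andP[? ?].
  by apply/andP; split; lra.
have [x||x xss' E] := @MVT_segment R f (derive1 f) s s' ss'.
- rewrite in_itv /= => /andP[sx xs']; have : ball t e x by apply: sub; rewrite !ltW.
  by move=> /fd dfx; rewrite derive1E; apply: DeriveDef.
- apply: derivable_within_continuous => x; rewrite in_itv /= => sxs'.
  exact/fd/sub.
exists x; move: xss'; rewrite in_itv /= => /andP[sx xs']; split => //.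
- by apply: sub; rewrite sx.
- by rewrite !ger0_norm ?subr_ge0// lerD2r.
- by rewrite distrC !ger0_norm ?subr_ge0// lerD2l lerN2.
Qed.

End LocalBounds.

Section Charts.
Variables (R : realType) (N : topologicalType).
Implicit Types (c : chart R N) (q : N).

Lemma chart_map_near c q (V : set R) : chart_dom c q -> nbhs (chart_map c q) V ->
  nbhs q [set q' | chart_dom c q' /\ V (chart_map c q')].
Proof.
move=> cq qV; have := @chart_map_continuous _ _ c.
rewrite continuous_open_subspace; last exact: open_chart_dom.
move=> /(_ q (mem_set cq)) /(_ _ qV) mV.
exact: filterI (open_nbhs_nbhs (conj (@open_chart_dom _ _ c) cq)) mV.
Qed.

Lemma chart_inv_near c t (V : set N) : chart_img c t -> nbhs (chart_inv c t) V ->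
  nbhs t [set s | chart_img c s /\ V (chart_inv c s)].
Proof.
move=> ct tV; have := @chart_inv_continuous _ _ c.
rewrite continuous_open_subspace; last exact: open_chart_img.
move=> /(_ t (mem_set ct)) /(_ _ tV) mV.
exact: filterI (open_nbhs_nbhs (conj (@open_chart_img _ _ c) ct)) mV.
Qed.

Lemma chart_map_img c q : chart_dom c q -> chart_img c (chart_map c q).
Proof. by move=> cq; exists q. Qed.

Lemma chart_inv_dom c t : chart_img c t -> chart_dom c (chart_inv c t).
Proof. by case=> q cq <-; rewrite chart_mapK. Qed.

Lemma chart_invK c t : chart_img c t -> chart_map c (chart_inv c t) = t.
Proof. by case=> q cq <-; rewrite chart_mapK. Qed.

End Charts.

Section Curve.
Variables (R : realType) (N : topologicalType) (M : manifold1 R N).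
Variable g : N -> 'rV[R]_2.
Hypothesis gs : smooth_map M g.
Implicit Types (c : chart R N) (q : N).

Let x c i (t : R) := g (chart_inv c t) 0 i.

Lemma smooth_coord i c : atlas M c -> smooth_on (chart_img c) (x c i).
Proof.
move=> /gs; exact: (smooth_on_coord (@open_chart_img _ _ c)).
Qed.

Arguments smooth_coord : clear implicits.

Lemma differentialE c q i : atlas M c -> chart_dom c q ->
  differential g c q 0 i = derive1 (x c i) (chart_map c q).
Proof.
move=> /gs cs cq.
have := coord_derive1n_smooth (@open_chart_img _ _ c) i cs 1
          (mem_set (chart_map_img cq)).
by rewrite /= /differential => ->.
Qed.

Lemma continuous_smooth_map q i : g z 0 i @[z --> q] --> g q 0 i.
Proof.
have [c cM cq] := atlas_cover M q.
have := derivable_continuous_at ((smooth_coord i _ cM) 0%N _ (chart_map_img cq)).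
rewrite /x /= chart_mapK// => gc.
move=> V /gc /(chart_map_near cq); apply: filterS => q' /= [cq' ].
by rewrite chart_mapK.
Qed.

(** The constants bound the coordinate, the curve and its first two derivatives
    near a point; the mean value theorem turns the bound on the second
    derivative into the Lipschitz and Taylor estimates. *)
Lemma local_tame c q : atlas M c -> chart_dom c q ->
  exists (U : set N) (k : nat), [/\ nbhs q U, U `<=` chart_dom c &
    tame g (chart_map c) (differential g c) U k].
Proof.
move=> cM cq; pose t := chart_map c q; have ct : chart_img c t by exact: chart_map_img.
have sx i := smooth_coord i _ cM.
have [k1 b1] : exists k : nat, \forall s \near t, `|s| <= k%:R.
  by apply: (@near_bounded _ id); exact: cvg_id.
have [k2 b2] : exists k : nat, \forall s \near t, forall i, `|x c i s| <= k%:R.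
  by apply: near_bounded2 => i; exact/derivable_continuous_at/(sx i 0%N).
have [k3 b3] : exists k : nat, \forall s \near t,
    forall i, `|derive1 (x c i) s| <= k%:R.
  by apply: near_bounded2 => i; exact/derivable_continuous_at/(sx i 1%N).
have [k4 b4] : exists k : nat, \forall s \near t,
    forall i, `|derive1n 2 (x c i) s| <= k%:R.
  by apply: near_bounded2 => i; exact/derivable_continuous_at/(sx i 2%N).
have b0 : \forall s \near t, chart_img c s by exact: (near_open (@open_chart_img _ _ c)).
have [e /= e0 be] : exists2 e : R, 0 < e & forall s, ball t e s ->
    [/\ chart_img c s, `|s| <= k1%:R, forall i, `|x c i s| <= k2%:R,
      forall i, `|derive1 (x c i) s| <= k3%:R &
      forall i, `|derive1n 2 (x c i) s| <= k4%:R].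
  apply/nbhs_ballP; near=> s; split; near: s; assumption.
have D0 i s : ball t e s -> derivable (x c i) s 1.
  by move=> /be[cs _ _ _ _]; exact: (sx i 0%N).
have D1 i s : ball t e s -> derivable (derive1 (x c i)) s 1.
  by move=> /be[cs _ _ _ _]; exact: (sx i 1%N).
pose k := (k1 + k2 + (k3 + k4))%N.
have kk : [/\ k1%:R <= k%:R :> R, k2%:R <= k%:R :> R,
    k3%:R <= k%:R :> R & k4%:R <= k%:R :> R].
  by rewrite !ler_nat /k; split; lia.
case: kk => kk1 kk2 kk3 kk4.
have lip i s s' : ball t e s -> ball t e s' ->
    `|derive1 (x c i) s' - derive1 (x c i) s| <= k%:R * `|s' - s|.
  move=> bs bs'; have [y [/be[_ _ _ _ by4] _ _ ->]] := mean_value (D1 i) bs bs'.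
  by rewrite normrM ler_wpM2r// (le_trans (by4 i)).
exists [set q' | chart_dom c q' /\ ball t e (chart_map c q')], k; split.
- by apply: chart_map_near => //; exact: nbhsx_ballx.
- by move=> ? [].
have gx q' i : chart_dom c q' -> g q' 0 i = x c i (chart_map c q').
  by move=> cq'; rewrite /x chart_mapK.
split.
- by move=> q' [_ /be[_ h _ _ _]]; exact: le_trans kk1.
- move=> q' i [cq' /be[_ _ /(_ i) h _ _]].
  by rewrite gx//; exact: le_trans kk2.
- move=> q' i [cq' /be[_ _ _ /(_ i) h _]].
  by rewrite differentialE//; exact: le_trans kk3.
- by move=> q1 q2 i [cq1 bq1] [cq2 bq2]; rewrite !differentialE//; exact: lip.
move=> q1 q2 i [cq1 bq1] [cq2 bq2]; rewrite differentialE// !gx//.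
have [y [bty yq _ ->]] := mean_value (D0 i) bq1 bq2.
rewrite -mulrBl normrM expr2 mulrA ler_wpM2r//.
by apply: le_trans (lip _ _ _ bq1 bty) _; rewrite ler_wpM2l.
Unshelve. all: by end_near. Qed.

(** Conditions on a tangent line that are homogeneous in the velocity can
    therefore be checked in a countable family of charts. *)
Lemma differential_chart_change c c' q : atlas M c -> atlas M c' ->
  chart_dom c q -> chart_dom c' q ->
  exists a, differential g c' q = a *: differential g c q.
Proof.
move=> cM cM' cq cq'; have [_ c'c] := atlas_compatible cM cM'.
exists (derive1 (chart_map c \o chart_inv c') (chart_map c' q)).
apply/rowP => i; rewrite mxE !differentialE//.
pose t := chart_map c' q.
have ct : chart_img c' t by exact: chart_map_img.
have dF : derivable (chart_map c \o chart_inv c') t 1 by apply: (c'c 0%N); exists q.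
rewrite -(_ : (chart_map c \o chart_inv c') t = chart_map c q); last first.
  by rewrite /= chart_mapK.
rewrite mulrC -derive1_comp//; last first.
  apply: ((smooth_coord i _ cM) 0%N); rewrite /= chart_mapK//; exact: chart_map_img.
rewrite !derive1E; apply: near_eq_derive.
have := chart_inv_near ct (V := chart_dom c); rewrite chart_mapK// => /(_ _)/filterS; apply.
  by move=> s /= [cs' cs]; rewrite /x /= chart_mapK.
by apply: open_nbhs_nbhs; split => //; exact: open_chart_dom.
Qed.

End Curve.

(** * Lines in general position are dense *)

Lemma nowhere_dense_sub (T : topologicalType) (A B : set T) :
  A `<=` B -> dense (~` closure B) -> dense (~` closure A).
Proof.
move=> AB dB O O0 Oo; have [x [Ox Bx]] := dB O O0 Oo.
by exists x; split=> // /(closure_subset AB).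
Qed.

Lemma nowhere_dense0 (T : topologicalType) : dense (~` closure (set0 : set T)).
Proof. by move=> O [x Ox] _; exists x; split => //; rewrite closure0. Qed.

Lemma natr_ge (R : realType) (a : R) : exists m : nat, a <= m%:R.
Proof.
by exists (Num.truncn a).+1; exact/ltW/truncnS_gt.
Qed.

Lemma natr_inv_ge (R : realType) (a : R) : a != 0 -> exists m : nat, 1 <= m%:R * `|a|.
Proof.
move=> a0; have [m am] := natr_ge (`|a|^-1); exists m.
by rewrite -ler_pdivrMr ?normr_gt0// div1r.
Qed.

Section GoodLines.
Variables (R : realType) (N : topologicalType) (M : manifold1 R N).
Variable g : N -> 'rV[R]_2.
Hypothesis (g_imm : immersion M g) (g_inj : injective g).
Implicit Types (c : chart R N) (q : N) (l : 'rV[R]_2).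

Definition nowhere_normal l := forall q c, atlas M c -> chart_dom c q ->
  on_line l (g q) -> along l (differential g c q) != 0.

Definition transverse_to_mirror l := forall q1 q2 c1 c2, q1 <> q2 ->
  atlas M c1 -> atlas M c2 -> chart_dom c1 q1 -> chart_dom c2 q2 ->
  mirror l (g q1) (g q2) ->
  ~ mirror_tangent l (differential g c1 q1) (differential g c2 q2).

Definition tame_piece (p : set N * chart R N * nat) :=
  [/\ atlas M p.1.2, p.1.1 `<=` chart_dom p.1.2 &
     tame g (chart_map p.1.2) (differential g p.1.2) p.1.1 p.2].

Lemma tame_sub t v (U V : set N) k : V `<=` U -> tame g t v U k -> tame g t v V k.
Proof.
by move=> VU [H1 H2 H3 H4 H5]; split => *;
  [apply: H1|apply: H2|apply: H3|apply: H4|apply: H5]; exact: VU.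
Qed.

(** Tameness is inherited by subsets, so the members of a countable basis that
    are tame in some chart already cover the manifold. A fixed chart and constant
    are chosen for each of them. *)
Lemma countable_tame_cover (q0 : N) : exists p : nat -> set N * chart R N * nat,
  forall q, exists2 n, tame_piece (p n) & (p n).1.1 q.
Proof.
have [c0 _ _] := atlas_cover M q0.
have [B cB [Bo Bb]] := manifold_second_countable M.
have [h hB] : exists h : nat -> set N, forall V, B V -> exists n, h n = V.
  have /pfcard_geP[->|/unsquash h] := cB; first by exists (fun=> set0).
  exists h => V BV.
  have [n _ <-] := @surj _ _ _ _ h V BV; by exists n.
have piece n : exists p, forall c k, tame_piece (h n, c, k) ->
    p.1.1 = h n /\ tame_piece p.
  have [[[c k] ck]|no] := pselect (exists ck, tame_piece (h n, ck.1, ck.2)).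
    by exists (h n, c, k).
  by exists (set0, c0, 0%N) => c k ck; case: no; exists (c, k).
have [p pP] := choice piece.
exists p => q; have [c cM cq] := atlas_cover M q.
have [gs _] := g_imm.
have [U [k [qU Uc tU]]] := local_tame gs cM cq.
have [V [BV Vq] VU] := Bb q U qU.
have [n hn] := hB V BV; exists n.
  apply: (pP n c k _).2; rewrite hn; split => //=; first exact: subset_trans VU Uc.
  exact: tame_sub tU.
rewrite (pP n c k _).1 ?hn//; split => //=; first exact: subset_trans VU Uc.
exact: tame_sub tU.
Qed.

Lemma along0_across (l w : 'rV[R]_2) : along l w = 0 -> across l w = 0 -> w = 0.
Proof.
move=> wl wa; apply: (@along_across_inj _ l);
  by rewrite ?wl ?wa /along /across !mxE; ring.
Qed.

Lemma differential_neq0 c q : atlas M c -> chart_dom c q -> differential g c q != 0.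
Proof.
move=> cM cq; have [_ /(_ c q cM cq)] := g_imm.
by apply: contraTneq => ->; rewrite -row_leq_rank mxrank0.
Qed.

(** Each bad line is bad for some tame pieces of the countable cover, with
    some natural number [m] in the bounds; the index [None] stands for the normal
    lines, [Some true] and [Some false] for the two kinds of mirror pairs. *)
Lemma good_lines_dense (O : set 'rV[R]_2) : open O -> O !=set0 ->
  exists2 l, O l & nowhere_normal l /\ transverse_to_mirror l.
Proof.
have [[q0 _]|noN] := pselect (exists q : N, True); last first.
  by move=> _ [l Ol]; exists l => //; split=> q; case: noN; exists q.
move=> Oo O0.
have [p pP] := countable_tame_cover q0.
pose c n := (p n).1.2; pose U n := (p n).1.1; pose k n := (p n).2.
pose v n := differential g (c n).
pose S (x : nat * nat * nat * option bool) : set 'rV[R]_2 :=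
  let: (i, j, m, b) := x in [set l | tame_piece (p i) /\ tame_piece (p j) /\
   match b with
   | None => exists q, [/\ U i q, on_line l (g q),
      along l (v i q) = 0, `|l 0 0| <= m%:R & 1 <= m%:R * `|v i q 0 1|]
   | Some true => exists z, mirror_pair g (v i) (U i) (v j) (U j) m z l /\
       1 <= m%:R * `|along l (v i z.1)|
   | Some false => exists z, mirror_pair g (v i) (U i) (v j) (U j) m z l /\
       (along l (v i z.1) = 0 /\ 1 <= m%:R * `|across l (v i z.1)|)
   end].
have Snd x : dense (~` closure (S x)).
  case: x => [[[i j] m] b].
  have [[[_ _ ti] [_ _ tj]]|no] :=
    pselect (tame_piece (p i) /\ tame_piece (p j)); last first.
    apply: nowhere_dense_sub (@nowhere_dense0 _).
    by move=> l [? [? _]]; apply: no.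
  case: b => [[]|].
  - by apply: nowhere_dense_sub (oblique_mirrors_nowhere_dense ti tj m)
       => l [_ []].
  - by apply: nowhere_dense_sub (perpendicular_mirrors_nowhere_dense ti tj m)
       => l [_ []].
  - by apply: nowhere_dense_sub (normal_lines_nowhere_dense m ti)
       => l [_ []].
have [l Ol Sl] := avoid_countably_many Snd Oo O0.
exists l => //; have [gs _] := g_imm.
have [m1 lm1] := natr_ge `|l 0 0|.
have mono (m m' : nat) (x : R) : (m <= m')%N ->
    1 <= m%:R * `|x| -> 1 <= m'%:R * `|x|.
  by move=> mm' /le_trans; apply; rewrite ler_wpM2r// ler_nat.
split=> [q cq cM qc lq|q1 q2 c1 c2 q12 cM1 cM2 qc1 qc2 mir tan].
  apply/eqP => vq; have [n pn qn] := pP q; have [cnM Uc _] := pn.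
  have [a va] := differential_chart_change gs cM cnM qc (Uc _ qn).
  have vnq : along l (v n q) = 0.
    by rewrite /v va alongZ vq mulr0.
  have vn1 : v n q 0 1 != 0.
    apply: contraTneq (differential_neq0 cnM (Uc _ qn)) => vn1; rewrite negbK.
    apply/eqP/(along0_across vnq).
    by move: vnq; rewrite /along /across vn1 mulr0 addr0 => ->; rewrite mulr0 subr0.
  have [m2 vm2] := natr_inv_ge vn1.
  apply: (Sl (n, n, (m1 + m2)%N, None)); do 2!split => //.
  exists q; split=> //; first by rewrite (le_trans lm1)// ler_nat leq_addr.
  by apply: mono vm2; rewrite ?leq_addl.
have [n1 pn1 qn1] := pP q1; have [cnM1 Uc1 _] := pn1.
have [n2 pn2 qn2] := pP q2; have [cnM2 Uc2 _] := pn2.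
have [a1 va1] := differential_chart_change gs cM1 cnM1 qc1 (Uc1 _ qn1).
have [a2 va2] := differential_chart_change gs cM2 cnM2 qc2 (Uc2 _ qn2).
have tann : mirror_tangent l (v n1 q1) (v n2 q2).
  by rewrite /v va1 va2; exact: mirror_tangentZ.
have y12 : g q2 0 1 - g q1 0 1 != 0.
  rewrite subr_eq0; apply/eqP => y12; apply: q12; apply: g_inj.
  by apply: row2P => //; have [] := mir; rewrite /along y12 => /addIr.
have [m2 ym2] := natr_inv_ge y12.
have pair (m : nat) : (m1 + m2 <= m)%N ->
    mirror_pair g (v n1) (U n1) (v n2) (U n2) m (q1, q2) l.
  move=> m12; split => //=.
    by rewrite (le_trans lm1)// ler_nat (leq_trans _ m12)// leq_addr.
  by apply: mono ym2; rewrite // (leq_trans _ m12)// leq_addl.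
have [along0|along0] := eqVneq (along l (v n1 q1)) 0.
  have across0 : across l (v n1 q1) != 0.
    apply: contraTneq (differential_neq0 cnM1 (Uc1 _ qn1)) => vn1; rewrite negbK.
    exact/eqP/(along0_across along0).
  have [m3 am3] := natr_inv_ge across0.
  apply: (Sl (n1, n2, (m1 + m2 + m3)%N, Some false)); do 2!split => //.
  exists (q1, q2); split; first by apply: pair; rewrite leq_addr.
  by split => //; apply: mono am3; rewrite ?leq_addl.
have [m3 am3] := natr_inv_ge along0.
apply: (Sl (n1, n2, (m1 + m2 + m3)%N, Some true)); do 2!split => //.
exists (q1, q2); split; first by apply: pair; rewrite leq_addr.
by apply: mono am3; rewrite ?leq_addl.
Qed.

End GoodLines.

(** * Distance-squared mappings with centres on a line *)

Section LineCoordinates.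
Variable R : realType.
Implicit Types (l x y w P : 'rV[R]_2).

Definition dot x y : R := x 0 0 * y 0 0 + x 0 1 * y 0 1.

Lemma on_line_across l P : on_line l P <-> across l P = l 0 1.
Proof. by rewrite /on_line /across; split; lra. Qed.

(** The scalar product in the orthogonal coordinates [along], [across]: a centre
    [P] on the line only contributes through [along l P]. *)
Lemma dot_line l x P w : on_line l P ->
  (1 + l 0 0 ^+ 2) * dot (x - P) w =
  (along l x - along l P) * along l w + (across l x - l 0 1) * across l w.
Proof. by rewrite /on_line /dot /along /across !mxE => ->; ring. Qed.

Lemma along_on_line_inj l P Q : on_line l P -> on_line l Q ->
  along l P = along l Q -> P = Q.
Proof.
move=> /on_line_across lP /on_line_across lQ /along_across_inj; apply.
by rewrite lP lQ.
Qed.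

(** [d10, d11] and [d20, d21] are the rows of the differential at two mirror
    images with tangents [(t1, n1)] and [(t2, n2)]; [a0] and [a1] are the
    positions along the line relative to the two centres, and [u], [- u] the
    signed distances to the line, in the coordinates [along], [across]. The rows are independent because their
    difference of columns isolates the [t] parts, which then isolates the [n]
    parts; up to sign, [t1 * n2 + n1 * t2] is the determinant of the tangents
    after reflecting one of them. *)
Lemma reflected_rows_independent (s a0 a1 u u' t1 n1 t2 n2 d10 d11 d20 d21 a b : R) :
  a0 - a1 != 0 -> u != 0 -> u' = - u -> t1 * n2 + n1 * t2 != 0 ->
  s * d10 = 2 * (a0 * t1 + u * n1) -> s * d11 = 2 * (a1 * t1 + u * n1) ->
  s * d20 = 2 * (a0 * t2 + u' * n2) -> s * d21 = 2 * (a1 * t2 + u' * n2) ->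
  a * d10 + b * d20 = 0 -> a * d11 + b * d21 = 0 -> a = 0 /\ b = 0.
Proof.
move=> a01 u0 -> T0 e10 e11 e20 e21 ab0 ab1.
have E0 : a * (a0 * t1 + u * n1) + b * (a0 * t2 - u * n2) = 0.
  have : s * (a * d10 + b * d20) = 0 by rewrite ab0 mulr0.
  by rewrite mulrDr !(mulrCA s) e10 e20; lra.
have E1 : a * (a1 * t1 + u * n1) + b * (a1 * t2 - u * n2) = 0.
  have : s * (a * d11 + b * d21) = 0 by rewrite ab1 mulr0.
  by rewrite mulrDr !(mulrCA s) e11 e21; lra.
have ab_t : a * t1 = - (b * t2).
  by apply: (mulfI a01); move: E0 E1; clear; lra.
have ab_n : a * n1 = b * n2.
  apply: (mulfI u0); move: E0.
  by rewrite mulrDr mulrBr !(mulrCA _ a0) ab_t; clear; lra.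
split; apply: (mulIf T0); rewrite mul0r mulrDr.
  by rewrite !mulrA ab_t ab_n; ring.
rewrite [t1 * _]mulrC [n1 * _]mulrC !mulrA -ab_n.
by rewrite (_ : b * t2 = - (a * t1)) ?ab_t ?opprK//; ring: ab_t.
Qed.

Lemma rowZD_coord x y (a b : R) i : (a *: x + b *: y) 0 i = a * x 0 i + b * y 0 i.
Proof. by rewrite !mxE. Qed.

End LineCoordinates.

Section GoodLineCenters.
Variables (R : realType) (N : topologicalType) (M : manifold1 R N).
Variable g : N -> 'rV[R]_2.
Hypothesis (g_imm : immersion M g) (g_inj : injective g).
Variables (l : 'rV[R]_2) (p : 'rV[R]_2 * 'rV[R]_2).
Hypotheses (lp1 : on_line l p.1) (lp2 : on_line l p.2) (p12 : p.1 != p.2).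
Implicit Types (c : chart R N) (q : N).

Let center (i : 'I_2) := if i == 0 then p.1 else p.2.

Let f := distance_squared p \o g.

Let fE q i : f q 0 i = dot (g q - center i) (g q - center i).
Proof. by rewrite /f /= mxE /center /dot; case: ifP => _; rewrite !mxE !expr2. Qed.

Let on_line_center i : on_line l (center i).
Proof. by rewrite /center; case: ifP. Qed.

Let along_center : along l (center 0) - along l (center 1) != 0.
Proof.
by rewrite subr_eq0; apply: contraNneq p12 => /(along_on_line_inj lp1 lp2) ->.
Qed.

Let curve c i (t : R) := g (chart_inv c t) 0 i.
Let sq c i : R -> R :=
  (curve c 0 - cst (center i 0 0)) * (curve c 0 - cst (center i 0 0)) +
  (curve c 1 - cst (center i 0 1)) * (curve c 1 - cst (center i 0 1)).

Let sqE c i t : sq c i t = (f \o chart_inv c) t 0 i.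
Proof. by rewrite /= fE /sq /dot /curve !fctE !mxE. Qed.

Lemma smooth_distance_squared : smooth_map M f.
Proof.
have [gs _] := g_imm.
move=> c cM; have co := @open_chart_img _ _ c.
apply: (smooth_on_row co) => i; apply/smooth_onP => n.
have xs j : diff_upto (chart_img c) n (curve c j).
  by move: n; apply/smooth_onP; exact: (smooth_coord gs).
apply: (@diff_upto_eq _ _ co _ n (sq c i)); first by move=> t _; rewrite sqE.
have xc j (a : R) : diff_upto (chart_img c) n (curve c j - cst a).
  rewrite (_ : _ - _ = curve c j + cst (- a))//.
  by apply: (diff_uptoD co) => //; exact: (diff_upto_cst co).
by apply: (diff_uptoD co); apply: (diff_uptoM co).
Qed.

Lemma differential_distance_squared c q i : atlas M c -> chart_dom c q ->
  differential f c q 0 i = 2 * dot (g q - center i) (differential g c q).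
Proof.
move=> cM cq; have [gs _] := g_imm.
rewrite (differentialE smooth_distance_squared)//.
rewrite -(funext (sqE c i)) derive1E.
have dx j : is_derive (chart_map c q) 1 (curve c j) (differential g c q 0 j).
  rewrite (differentialE gs)// derive1E; apply: DeriveDef => //.
  exact: (@smooth_coord _ _ _ _ gs j _ cM 0%N _ (chart_map_img cq)).
have dc j a : is_derive (chart_map c q) 1 (curve c j - cst a)
                (differential g c q 0 j).
  by rewrite -[X in is_derive _ _ _ X]subr0; exact: is_deriveB.
have ds j a := is_deriveM (dc j a) (dc j a).
rewrite (derive_val (is_derive :=
  is_deriveD (ds 0 (center i 0 0)) (ds 1 (center i 0 1)))).
rewrite /curve !fctE chart_mapK// /dot !mxE /GRing.scale /=.
ring.
Qed.

Let along_across_dist q i : (1 + l 0 0 ^+ 2) * f q 0 i =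
  (along l (g q) - along l (center i)) ^+ 2 + (across l (g q) - l 0 1) ^+ 2.
Proof.
rewrite fE (dot_line _ _ (on_line_center i)) /along /across !mxE.
have := on_line_center i; rewrite /on_line => ->; ring.
Qed.

(** Equal squared distances to two distinct points of a line give equal
    positions along the line and equal squared distances to the line. *)
Lemma equal_values q q' : f q = f q' -> q <> q' -> mirror l (g q) (g q').
Proof.
move=> fqq' qq'.
have E i :
  (along l (g q) - along l (center i)) ^+ 2 + (across l (g q) - l 0 1) ^+ 2 =
  (along l (g q') - along l (center i)) ^+ 2 + (across l (g q') - l 0 1) ^+ 2.
  by rewrite -!along_across_dist fqq'.
have al : along l (g q) = along l (g q').
  apply: (mulIf along_center); move: (E 0) (E 1); lra.
split=> //; have /eqP := E 0; rewrite al => /eqP/addrI/eqP.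
rewrite eqf_sqr => /orP[/eqP/addIr ac|/eqP]; last by lra.
by case: qq'; apply: g_inj; exact: along_across_inj ac.
Qed.

(** A point has only one mirror image, and the curve is injective. *)
Lemma fiber_le2 y : (f @^-1` [set y] #<= `I_2)%card.
Proof.
have [[q fq]|no] := pselect (exists q, f q = y); last first.
  rewrite (_ : _ @^-1` _ = set0) ?card_le0x//; apply/seteqP; split=> // q fq.
  by apply: no; exists q.
have [q' fq'] : exists q', forall z, f z = y -> z = q \/ z = q'.
  have [[q' [fq' qq']]|no] := pselect (exists q', f q' = y /\ q' <> q); last first.
    exists q => z fz; left; apply: contrapT => zq; apply: no; by exists z.
  exists q' => z fz; apply: contrapT => /not_orP[zq zq'].
  have m1 := equal_values (etrans fq' (esym fq)) qq'.
  have m2 := equal_values (etrans fz (esym fq)) zq.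
  apply: zq'; apply: g_inj; apply: (@along_across_inj _ l).
    by rewrite m1.1 m2.1.
  by apply: (addIr (across l (g q))); rewrite m1.2 m2.2.
pose h n := if n == 0%N then q else q'.
apply: (@card_le_trans _ _ _ (h @` `I_2)); last exact: card_image_le.
apply: subset_card_le => z /fq'[] ->; first by exists 0%N.
by exists 1%N.
Qed.

(** If both derivatives vanish, so does their difference, and the velocity is
    orthogonal to the line; as it is nonzero, the point itself lies on the line,
    which is then normal to the curve. *)
Lemma immersion_distance_squared : nowhere_normal M g l -> immersion M f.
Proof.
move=> nn; split; first exact: smooth_distance_squared.
move=> c q cM cq; rewrite /row_free rank_rV eqb1; apply/eqP => d0.
set v := differential g c q.
have E i : (along l (g q) - along l (center i)) * along l v +
    (across l (g q) - l 0 1) * across l v = 0.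
  rewrite -(dot_line _ _ (on_line_center i)).
  have /esym/eqP := differential_distance_squared i cM cq.
  by rewrite d0 mxE mulf_eq0 pnatr_eq0 /= => /eqP ->; rewrite mulr0.
have al : along l v = 0.
  apply: (mulfI along_center); rewrite mulr0; move: (E 0) (E 1); lra.
have ac : across l v != 0.
  apply: contraTneq (differential_neq0 g_imm cM cq) => ac; rewrite negbK.
  exact/eqP/(along0_across al).
have := E 0; rewrite al mulr0 add0r => /eqP.
rewrite mulf_eq0 (negbTE ac) orbF subr_eq0.
by move=> /eqP/on_line_across/(nn _ _ cM cq); rewrite -/v al eqxx.
Qed.

Lemma transversal_distance_squared q1 q2 c1 c2 : transverse_to_mirror M g l ->
  q1 <> q2 -> f q1 = f q2 -> atlas M c1 -> chart_dom c1 q1 ->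
  atlas M c2 -> chart_dom c2 q2 ->
  \rank (differential f c1 q1 + differential f c2 q2)%MS = 2%N.
Proof.
move=> tr q12 f12 cM1 cq1 cM2 cq2.
have [mal mac] := equal_values f12 q12.
have ntan := tr _ _ _ _ q12 cM1 cM2 cq1 cq2 (conj mal mac).
have reflected : across l (g q2) - l 0 1 = - (across l (g q1) - l 0 1) by lra.
have off_line : across l (g q1) - l 0 1 != 0.
  apply: contra_notN q12 => /eqP on_l; apply: g_inj.
  apply: (along_across_inj mal); move: reflected.
  by rewrite on_l oppr0; lra.
have D q c i : atlas M c -> chart_dom c q ->
   (1 + l 0 0 ^+ 2) * differential f c q 0 i =
   2 * ((along l (g q) - along l (center i)) * along l (differential g c q) +
        (across l (g q) - l 0 1) * across l (differential g c q)).
  move=> cM cq; rewrite differential_distance_squared// mulrCA.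
  by rewrite (dot_line _ _ (on_line_center i)).
rewrite addsmxE; apply/eqP/inj_row_free => u.
rewrite -[u]hsubmxK mul_row_col [lsubmx u]mx11_scalar [rsubmx u]mx11_scalar.
rewrite !mul_scalar_mx => ab0.
have ab i := congr1 (fun A : 'rV[R]_2 => A 0 i) ab0.
have := ab 0; have := ab 1; rewrite !rowZD_coord [LHS]/= => ab1' ab0'.
have centers : (along l (g q1) - along l (center 0)) -
               (along l (g q1) - along l (center 1)) != 0.
  by rewrite opprB addrC addrA subrK -oppr_eq0 opprB.
have D20 := D q2 c2 0 cM2 cq2; have D21 := D q2 c2 1 cM2 cq2.
rewrite -mal in D20 D21.
have [-> ->] := reflected_rows_independent centers off_line reflected
  (introN eqP ntan) (D q1 c1 0 cM1 cq1) (D q1 c1 1 cM1 cq1) D20 D21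
  (etrans ab0' (mxE _ _ _ _)) (etrans ab1' (mxE _ _ _ _)).
by rewrite !raddf0 row_mx0.
Qed.

Lemma good_line_normal_crossings :
  nowhere_normal M g l -> transverse_to_mirror M g l ->
  immersion_with_normal_crossings M f.
Proof.
move=> nn tr; split; first exact: immersion_distance_squared.
split; first exact: fiber_le2.
move=> q1 q2 q12 f12 c1 c2 cM1 cq1 cM2 cq2.
exact: transversal_distance_squared.
Qed.

End GoodLineCenters.

(** * Choice of the two centres *)

Lemma det_mx22 (R : comNzRingType) (A : 'M[R]_2) :
  \det A = A 0 0 * A 1 1 - A 0 1 * A 1 0.
Proof.
rewrite (expand_det_row _ 0) !big_ord_recl big_ord0 addr0 /cofactor !det_mx11.
rewrite !mxE /= expr0 expr1 mul1r mulN1r mulrN.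
congr (_ * A _ _ - A _ _ * A _ _); exact: val_inj.
Qed.

Lemma common_direction (R : fieldType) (p q r s u v : R) :
  p * v = q * u -> r * v = s * u -> (u != 0) || (v != 0) -> q * r = p * s.
Proof.
move=> pq rs /orP[u0|v0]; [apply: (mulIf u0)|apply: (mulIf v0)].
  by rewrite mulrAC -pq mulrAC -mulrA rs mulrA.
by rewrite -mulrA rs mulrCA -pq mulrCA mulrA.
Qed.

Section OneVariable.
Variable R : realType.

Lemma sign_change (f : R -> R) t : derivable f t 1 -> f t = 0 -> derive1 f t != 0 ->
  exists2 r : R, 0 < r & forall e, 0 < e < r ->
    0 < derive1 f t * f (t + e) /\ derive1 f t * f (t - e) < 0.
Proof.
rewrite derive1E => df ft D0; set D := 'D_1 f t in D0 *.
have lim : D * (h^-1 *: ((f \o shift t) (h *: 1) - f t)) @[h --> 0^'] --> D * D.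
  by apply: cvgMl_tmp; exact: df.
have DD : 0 < D * D by rewrite -expr2 exprn_even_gt0.
have [r /= r0 rP] := cvgr_gt _ lim _ DD.
exists r => // e /andP[e0 er].
have P h : h != 0 -> `|h| < r -> 0 < D * (h^-1 * f (t + h)).
  move=> h0 hr; have := rP h; rewrite /ball /= sub0r normrN => /(_ hr h0).
  by rewrite ft subr0 /GRing.scale /= mulr1 addrC.
split.
  have := P e (lt0r_neq0 e0); rewrite gtr0_norm// => /(_ er).
  by rewrite mulrCA pmulr_rgt0// invr_gt0.
have := P (- e); rewrite oppr_eq0 (lt0r_neq0 e0) normrN gtr0_norm// => /(_ isT er).
by rewrite mulrCA nmulr_rgt0// invr_lt0 oppr_lt0.
Qed.

Lemma derive1_cross (x y : R -> R) (a b : R) t :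
  derivable x t 1 -> derivable y t 1 ->
  derivable (derive1 x) t 1 -> derivable (derive1 y) t 1 ->
  derive1 (fun s => derive1 x s * (b - y s) - derive1 y s * (a - x s)) t =
  derive1n 2 x t * (b - y t) - derive1n 2 y t * (a - x t).
Proof.
move=> dx dy ddx ddy; rewrite derive1E.
have D (f : R -> R) : derivable f t 1 -> is_derive t 1 f (derive1 f t).
  by move=> df; rewrite derive1E; exact: DeriveDef.
have DQ (f : R -> R) c : derivable f t 1 -> is_derive t 1 (cst c - f) (0 - derive1 f t).
  by move=> /D df; exact: is_deriveB.
rewrite (derive_val (is_derive := is_deriveB (is_deriveM (D _ ddx) (DQ y b dy))
     (is_deriveM (D _ ddy) (DQ x a dx)))).
rewrite !fctE /GRing.scale /= /derive1n /=.
by move: (derive1 x t) (derive1 y t) (derive1 (derive1 x) t) => x' y' x''; ring.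
Qed.

Lemma continuous_affine (T : topologicalType) (a b : T -> R) (c u v : R) :
  continuous a -> continuous b -> continuous (fun l => c * (u - (a l * v + b l))).
Proof.
move=> ac bc l; apply: cvgM; first exact: cvg_cst.
apply: cvgB; first exact: cvg_cst.
apply: cvgD; last exact: bc.
by apply: cvgM; [exact: ac|exact: cvg_cst].
Qed.

End OneVariable.

Section Selection.
Variables (R : realType) (N : topologicalType) (M : manifold1 R N).
Variable g : N -> 'rV[R]_2.
Hypothesis (g_imm : immersion M g) (g_inj : injective g).
Hypothesis g_curv : nowhere_locally_flat M g.
Implicit Types (c : chart R N) (q : N) (U : set N).

Definition cross (x y : 'rV[R]_2) : R := x 0 0 * y 0 1 - x 0 1 * y 0 0.

Lemma crossN x y : cross x (- y) = - cross x y.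
Proof. by rewrite /cross !mxE; ring. Qed.

Let gs : smooth_map M g. Proof. by case: g_imm. Qed.

(** If all tangents near [q] pass through the fixed point [Q], differentiating
    this condition makes the acceleration at [q] parallel to the nonzero vector
    [Q - g q] as well, hence to the velocity. *)
Lemma curvature_eq0 c q (Q : 'rV[R]_2) : atlas M c -> chart_dom c q -> g q != Q ->
  (\forall q' \near q, chart_dom c q' ->
     cross (differential g c q') (Q - g q') = 0) ->
  curvature g c q = 0.
Proof.
move=> cM cq gQ near0; pose t := chart_map c q.
have ct : chart_img c t by exact: chart_map_img.
pose x i s := g (chart_inv c s) 0 i.
have dx i : derivable (x i) t 1 := @smooth_coord _ _ _ _ gs i c cM 0%N t ct.
have ddx i : derivable (derive1 (x i)) t 1 := @smooth_coord _ _ _ _ gs i c cM 1%N t ct.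
pose h s := derive1 (x 0) s * (Q 0 1 - x 1 s) -
            derive1 (x 1) s * (Q 0 0 - x 0 s).
have h0 : \forall s \near t, h s = 0.
  have := chart_inv_near ct (V := [set q' | chart_dom c q' ->
            cross (differential g c q') (Q - g q') = 0]).
  rewrite chart_mapK// => /(_ near0); apply: filterS => s [cs /= hs].
  have := hs (chart_inv_dom cs).
  rewrite /cross !(differentialE gs)//; try exact: chart_inv_dom.
  by rewrite chart_invK// !mxE.
have ht : h t = 0 by exact: nbhs_singleton h0.
have E : derive1n 2 (x 0) t * (Q 0 1 - x 1 t) -
         derive1n 2 (x 1) t * (Q 0 0 - x 0 t) = 0.
  have dh : derive1 h t = 0.
    rewrite derive1E (near_eq_derive (g := cst 0)) ?derive_cst//; exact: h0.
  by rewrite -dh (derive1_cross _ _ (dx 0) (dx 1) (ddx 0) (ddx 1)).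
have ht' : derive1 (x 0) t * (Q 0 1 - x 1 t) -
           derive1 (x 1) t * (Q 0 0 - x 0 t) = 0.
  by rewrite -ht.
have Qx : (Q 0 0 - x 0 t != 0) || (Q 0 1 - x 1 t != 0).
  rewrite -negb_and; apply: contra gQ; rewrite !subr_eq0 /x /t chart_mapK//.
  by move=> /andP[/eqP Q0 /eqP Q1]; apply/eqP/row2P.
have flat := common_direction (subr0_eq ht') (subr0_eq E) Qx.
rewrite /curvature det_mx22 !mxE /= -/t mulrN mulNr opprK.
apply/eqP; rewrite mulf_eq0; apply/orP; left; rewrite addrC subr_eq0; apply/eqP.
exact/esym.
Qed.

Lemma tangent_misses U (Q : 'rV[R]_2) : open U -> U !=set0 ->
  (forall q, U q -> g q != Q) ->
  exists q c, [/\ U q, atlas M c, chart_dom c q &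
    cross (differential g c q) (Q - g q) != 0].
Proof.
move=> Uo U0 UQ; apply: contrapT => no.
have [q [c [Uq cM cq]]] := g_curv Uo U0.
apply/negP; rewrite negbK; apply/eqP/(curvature_eq0 cM cq (UQ _ Uq)).
apply: filterS (open_nbhs_nbhs (conj Uo Uq)) => q' Uq' cq'.
by apply: contrapT => /eqP ne; apply: no; exists q', c.
Qed.

Lemma abscissa_varies U (x0 : R) : open U -> U !=set0 -> exists2 q, U q & g q 0 0 != x0.
Proof.
move=> Uo U0; apply: contrapT => no.
have {}no q : U q -> g q 0 0 = x0.
  by move=> Uq; apply: contrapT => /eqP ne; apply: no; exists q.
have [q [c [Uq cM cq]]] := g_curv Uo U0.
apply/negP; rewrite negbK; apply/eqP.
(* On a vertical segment all tangents pass through the point one unit above. *)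
apply: (@curvature_eq0 c q (\row_i if i == 0 then x0 else g q 0 1 + 1)) => //.
  apply/eqP => /(congr1 (fun A : 'rV[R]_2 => A 0 1)); rewrite mxE /=; lra.
apply: filterS (open_nbhs_nbhs (conj Uo Uq)) => q' Uq' cq'.
rewrite /cross !mxE /= no// subrr mulr0 subr0 (differentialE gs)//.
rewrite derive1E (near_eq_derive (g := cst x0)) ?derive_cst ?mul0r//.
have := @chart_inv_near _ _ c _ U (chart_map_img cq'); rewrite chart_mapK//.
move=> /(_ (open_nbhs_nbhs (conj Uo Uq'))); apply: filterS => s [_ /= Us]; exact: no.
Qed.

Lemma open_nonzero (h : N -> R) : (forall q, h z @[z --> q] --> h q) ->
  open [set q | h q != 0].
Proof. by move=> hc; rewrite openE => q hq; exact: (cvgr_neq0 _ (hc q) hq). Qed.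

Lemma open_abscissa_neq (a : R) : open [set q | g q 0 0 - a != 0].
Proof.
apply: open_nonzero => q; apply: cvgB; last exact: cvg_cst.
exact: (@continuous_smooth_map _ _ _ _ gs q 0).
Qed.

Lemma open_cross_neq0 (w X : 'rV[R]_2) : open [set q | cross w (g q - X) != 0].
Proof.
apply: open_nonzero => q; rewrite /cross.
have gc i : (g z - X) 0 i @[z --> q] --> (g q - X) 0 i.
  rewrite !mxE; under eq_fun do rewrite !mxE.
  by apply: cvgB; [exact: (@continuous_smooth_map _ _ _ _ gs q i)|exact: cvg_cst].
by apply: cvgB; apply: cvgMl_tmp; exact: gc.
Qed.

(** The abscissas must differ for the chord to be a line [y = a x + b]. The
    conditions are open, so they can be obtained one after the other: each by
    moving an endpoint inside the open piece where the previous ones hold. *)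
Lemma oblique_pair U1 U2 : open U1 -> U1 !=set0 -> open U2 -> U2 !=set0 ->
  exists q1 q2 c1 c2, [/\ U1 q1 /\ U2 q2, g q2 0 0 - g q1 0 0 != 0,
    atlas M c1 /\ atlas M c2, chart_dom c1 q1 /\ chart_dom c2 q2 &
    cross (differential g c1 q1) (g q2 - g q1) != 0 /\
    cross (differential g c2 q2) (g q2 - g q1) != 0].
Proof.
move=> o1 U10 o2 [q20 Uq20].
have [q10 Uq10 x10] := abscissa_varies (g q20 0 0) o1 U10.
pose V1 := U1 `&` [set q | g q 0 0 - g q20 0 0 != 0].
have V1o : open V1 by apply: openI => //; exact: open_abscissa_neq.
have [|q /= [_]|q1 [c1 [[/= Uq1 x1] cM1 cq1 cr1]]] :=
  @tangent_misses V1 (g q20) V1o.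
- by exists q10; split => //=; rewrite subr_eq0.
- by apply: contraNneq => ->; rewrite subrr.
pose V2 := U2 `&` ([set q | g q 0 0 - g q1 0 0 != 0] `&`
  [set q | cross (differential g c1 q1) (g q - g q1) != 0]).
have V2o : open V2.
  apply: openI => //; apply: openI; [exact: open_abscissa_neq|exact: open_cross_neq0].
have [|q /= [_ []]|q2 [c2 [[/= Uq2 [x2 cr12]] cM2 cq2 cr2]]] :=
  @tangent_misses V2 (g q1) V2o.
- by exists q20; do 2!split => //=; rewrite -opprB oppr_eq0.
- by move=> x1q _; apply: contraNneq x1q => ->; rewrite subrr.
exists q1, q2, c1, c2; split; [exact: conj|exact: x2|exact: conj|exact: conj|].
split; first exact: cr12.
by rewrite -opprB crossN oppr_eq0.
Qed.

(** The function [F l] below measures the height of the curve above the line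
    [l]. As [l0] is transverse to the curve, [F l0] has opposite signs on the two
    sides of [q]; this persists for lines near [l0]. *)
Lemma nearby_lines_cross c q (V : set N) (l0 : 'rV[R]_2) :
  atlas M c -> chart_dom c q ->
  nbhs q V -> on_line l0 (g q) -> across l0 (differential g c q) != 0 ->
  \forall l \near l0, exists2 q', V q' & on_line l (g q').
Proof.
move=> cM cq qV l0q ac0; pose t := chart_map c q.
have ct : chart_img c t by exact: chart_map_img.
pose x i s := g (chart_inv c s) 0 i.
pose F (l : 'rV[R]_2) (s : R) : R := x 1 s - (l 0 0 * x 0 s + l 0 1).
have dx i s : chart_img c s -> derivable (x i) s 1.
  exact: (@smooth_coord _ _ _ _ gs i c cM 0%N s).
have dF l s : chart_img c s ->
    is_derive s 1 (F l) (derive1 (x 1) s - l 0 0 * derive1 (x 0) s).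
  move=> cs; have D i : is_derive s 1 (x i) (derive1 (x i) s).
    by rewrite derive1E; apply: DeriveDef => //; exact: dx.
  apply: (is_derive_eq (is_deriveB (D 1) (is_deriveD (is_deriveZ (l 0 0) (D 0))
    (is_derive_cst (l 0 1) s 1)))).
  by rewrite addr0.
have Ft : F l0 t = 0 by rewrite /F /x /t chart_mapK// l0q subrr.
have DF : derive1 (F l0) t = across l0 (differential g c q).
  rewrite derive1E (derive_val (is_derive := dF l0 t ct)) /across.
  by rewrite !(differentialE gs).
have [r r0 sgn] : exists2 r : R, 0 < r & forall e, 0 < e < r ->
    0 < derive1 (F l0) t * F l0 (t + e) /\ derive1 (F l0) t * F l0 (t - e) < 0.
  apply: sign_change; rewrite ?DF//.
  exact: (ex_derive (is_derive := dF l0 t ct)).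
have [r' /= r'0 r'P] : exists2 r' : R, 0 < r' & forall s, ball t r' s ->
    chart_img c s /\ V (chart_inv c s).
  by apply/nbhs_ballP/chart_inv_near => //; rewrite chart_mapK.
pose e := Num.min r r' / 2.
have e0 : 0 < e by rewrite divr_gt0// lt_min r0.
have er : e < r.
  rewrite ltr_pdivrMr// (@le_lt_trans _ _ r)// ?ltr_pMr ?ltr1n//.
  by rewrite ge_min lexx.
have er' : e < r'.
  rewrite ltr_pdivrMr// (@le_lt_trans _ _ r')// ?ltr_pMr ?ltr1n//.
  by rewrite ge_min lexx orbT.
set D := derive1 (F l0) t in sgn.
have [sp sm] : 0 < D * F l0 (t + e) /\ D * F l0 (t - e) < 0 by apply: sgn; rewrite e0.
have Fc s : continuous (fun l : 'rV[R]_2 => D * F l s).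
  by apply: continuous_affine; exact: coord_continuous.
apply: filterS2 (cvgr_gt _ (Fc (t + e) l0) _ sp)
                (cvgr_lt _ (Fc (t - e) l0) _ sm) => l Fp Fm.
have sub s : t - e <= s <= t + e -> ball t r' s.
  move=> /andP[? ?]; rewrite /ball /= ltr_norml; apply/andP; split; lra.
have [s st Fs] : exists2 s, s \in `[t - e, t + e] & D * F l s = 0.
  apply: IVT; first lra.
    apply: derivable_within_continuous => s; rewrite in_itv /= => /sub/r'P[cs _].
    have dFs := dF l s cs.
    exact: (@derivableM _ _ (cst D) (F l)).
  by rewrite ge_min le_max (ltW Fm) (ltW Fp) orbT.
have /r'P[cs Vs] : ball t r' s by apply: sub; move: st; rewrite in_itv.
exists (chart_inv c s) => //; apply/eqP; rewrite -subr_eq0.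
by move/eqP: Fs; rewrite mulf_eq0 /D DF (negbTE ac0).
Qed.

End Selection.

Theorem theorem1 (R : realType) (N : topologicalType) (M : manifold1 R N)
    (gamma : N -> 'rV[R]_2)
    (gamma_inj : injective gamma)
    (gamma_imm : immersion M gamma)
    (gamma_curv : nowhere_locally_flat M gamma) :
  dense [set p : set_type (range gamma `*` range gamma) |
    immersion_with_normal_crossings M (distance_squared (val p) \o gamma)].
Proof.
move=> O [[x xP] Ox] [W Wo WE].
have [gs _] := gamma_imm.
have Wx : W x by rewrite -WE in Ox.
have [[q10 _ gq10] [q20 _ gq20]] := set_mem xP.
have [[A1 A2] /= [nA1 nA2] AW] : nbhs (gamma q10, gamma q20) W.
  by rewrite gq10 gq20 -surjective_pairing; exact: open_nbhs_nbhs.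
have gc q A : nbhs (gamma q) A -> nbhs q (gamma @^-1` A).
  move: A; suff : gamma z @[z --> q] --> gamma q by apply.
  apply/cvg_ballP => e e0.
  suff : forall i : 'I_2, \forall z \near q, `|gamma q 0 i - gamma z 0 i| < e.
    move=> gi; apply: filterS2 (gi 0) (gi 1) => z z0 z1; apply/ball_rowP => // j.
    by case: (altP (j =P 0)) => [->//|j0]; rewrite (@ord2_other 0 1 j).
  by move=> j; have /cvgr_dist_lt/(_ _ e0) := @continuous_smooth_map _ _ _ _ gs q j.
have [q1 [q2 [c1 [c2 [[Uq1 Uq2] x12 [cM1 cM2] [cq1 cq2] [cr1 cr2]]]]]] :=
  oblique_pair gamma_imm gamma_curv (@open_interior _ _) (ex_intro _ q10 (gc _ _ nA1))
     (@open_interior _ _) (ex_intro _ q20 (gc _ _ nA2)).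
(* Points of the curve within [d] of the endpoints have distinct abscissas, so
   the two centres found below are distinct. *)
pose d := `|gamma q2 0 0 - gamma q1 0 0| / 3.
have d0 : 0 < d by rewrite divr_gt0// normr_gt0.
have nV q A : interior (gamma @^-1` A) q -> nbhs q ((gamma @^-1` A) `&`
    [set q' | `|gamma q 0 0 - gamma q' 0 0| < d]).
  move=> Aq; apply: filterI => //.
  by have /cvgr_dist_lt/(_ _ d0) := @continuous_smooth_map _ _ _ _ gs q 0.
pose a := (gamma q2 0 1 - gamma q1 0 1) / (gamma q2 0 0 - gamma q1 0 0).
pose l0 : 'rV[R]_2 :=
  \row_i (if i == 0 then a else gamma q1 0 1 - a * gamma q1 0 0).
have l0q1 : on_line l0 (gamma q1) by rewrite /on_line !mxE /=; ring.
have l0q2 : on_line l0 (gamma q2) by rewrite /on_line !mxE /= /a; field.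
have across_cross w : cross w (gamma q2 - gamma q1) =
    - (gamma q2 0 0 - gamma q1 0 0) * across l0 w.
  by rewrite /cross /across !mxE /= /a; field.
have across0 w : cross w (gamma q2 - gamma q1) != 0 -> across l0 w != 0.
  by rewrite across_cross mulf_eq0 negb_or => /andP[].
have near_l1 :=
  nearby_lines_cross gamma_imm cM1 cq1 (nV _ _ Uq1) l0q1 (across0 _ cr1).
have near_l2 :=
  nearby_lines_cross gamma_imm cM2 cq2 (nV _ _ Uq2) l0q2 (across0 _ cr2).
have near_l : nbhs l0 [set l |
    (exists2 q, (gamma @^-1` A1) q /\ `|gamma q1 0 0 - gamma q 0 0| < d &
       on_line l (gamma q)) /\
    (exists2 q, (gamma @^-1` A2) q /\ `|gamma q2 0 0 - gamma q 0 0| < d &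
       on_line l (gamma q))].
  exact: filterI near_l1 near_l2.
have [l /interior_subset [[q1' [A1q1 d1] lq1] [q2' [A2q2 d2] lq2]] [nn tr]] :=
  good_lines_dense gamma_imm gamma_inj (@open_interior _ _)
    (ex_intro _ l0 near_l).
have p12 : gamma q1' != gamma q2'.
  apply/eqP => E; move: d1; rewrite /= E => d1.
  have := normB_le (ltW d2) (ltW d1); rewrite opprB addrA subrK.
  by move: d0; rewrite /d; clear; lra.
have P : (gamma q1', gamma q2') \in range gamma `*` range gamma.
  by rewrite inE; split; [exists q1'|exists q2'].
exists (exist _ (gamma q1', gamma q2') P); split.
  by rewrite -WE; apply: AW.
exact: (@good_line_normal_crossings _ _ _ _ gamma_imm gamma_inj l
         (gamma q1', gamma q2')).
Qed.
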